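(* For all fixed constants $k$ and $d$, MPB can be solved in polynomial time on PB instances whose number of distinct approval votes is at most $k$ and whose scalable limit is at most $d$; that is, there is a polynomial-time algorithm that, given such an instance, finds a feasible $S\subseteq P$ maximizing $\min_{i\in N}u_i(S)$.
   Context: A PB instance is $\langle N,P,c,b,\mathcal{A}\rangle$ with voters $N=\{1,\dots,n\}$, projects $P=\{p_1,\dots,p_m\}$, costs $c:P\to\mathbb{N}$, budget $b\in\mathbb{N}$, and approval sets $A_i\subseteq P$ for $i\in N$. $c(S)=\sum_{p\in S}c(p)$; $S$ is feasible if $c(S)\le b$; $u_i(S)=c(S\cap A_i)$. The number of distinct votes is the number of distinct sets among $A_1,\dots,A_n$. The scalable limit of the instance is $\delta=\frac{\max(c(p_1),\dots,c(p_m))}{\gcd(c(p_1),\dots,c(p_m),b)}$. *)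

(* Defs.v *)
From mathcomp Require Import all_boot all_order all_algebra.
Set Implicit Arguments. Unset Strict Implicit. Unset Printing Implicit Defensive.
Import Order.TTheory GRing.Theory Num.Theory.

Record PB := MkPB {
  nV : nat;
  nP : nat;
  cst : {ffun 'I_nP -> nat};
  bud : nat;
  appr : {ffun 'I_nV -> {set 'I_nP}}
}.

Definition costS (I : PB) (S : {set 'I_(nP I)}) : nat :=
  \sum_(p in S) cst I p.

Definition feasible (I : PB) (S : {set 'I_(nP I)}) : bool :=
  costS S <= bud I.

Definition util (I : PB) (i : 'I_(nV I)) (S : {set 'I_(nP I)}) : nat :=
  costS (S :&: appr I i).

(* min_{i in N} u_i(S); the neutral element c(P) is an upper bound of every
   u_i(S), so this is the usual minimum whenever N is nonempty. *)
Definition egal (I : PB) (S : {set 'I_(nP I)}) : nat :=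
  \big[minn/costS [set: 'I_(nP I)]]_(i : 'I_(nV I)) util i S.

Definition mpb_solution (I : PB) (S : {set 'I_(nP I)}) : Prop :=
  feasible S /\ forall T : {set 'I_(nP I)}, feasible T -> egal T <= egal S.

Definition distinct_votes (I : PB) : nat :=
  #|[set appr I i | i : 'I_(nV I)]|.

Definition scalable_limit (I : PB) : rat :=
  ((\max_(p : 'I_(nP I)) cst I p)%:R /
   (gcdn (\big[gcdn/0]_(p : 'I_(nP I)) cst I p) (bud I))%:R)%R.

(* number of binary digits of n (1 for n = 0) *)
Definition bits (n : nat) : nat := (trunc_log 2 n).+1.

Inductive instr :=
| IConst (r v : nat)
| IAdd (r a b : nat)
| ISub (r a b : nat)        (* R[r] := R[a] - R[b] (truncated) *)
| IMul (r a b : nat)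
| IDiv (r a b : nat)        (* R[r] := R[a] %/ R[b] (x %/ 0 = 0) *)
| ILoad (r a : nat)
| IStore (a r : nat)
| IJz (r l : nat)
| IHalt.

Definition program := seq instr.
Definition memory := nat -> nat.

Definition upd (M : memory) (a v : nat) : memory :=
  fun x => if x == a then v else M x.

Definition addc (c : nat) (o : option (memory * nat)) : option (memory * nat) :=
  match o with Some (M, t) => Some (M, t + c) | None => None end.

(* exec p fuel pc M = Some (M', t) iff the program started at pc on memory M
   halts within fuel steps with final memory M' and total (log-)cost t.
   Running past the end of the program halts. *)
Fixpoint exec (p : program) (fuel pc : nat) (M : memory) : option (memory * nat) :=
  match fuel with
  | 0 => None
  | f.+1 =>
    match nth IHalt p pc with
    | IHalt => Some (M, 0)
    | IConst r v => addc (1 + bits r + bits v) (exec p f pc.+1 (upd M r v))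
    | IAdd r a b => addc (1 + bits r + bits a + bits b + bits (M a) + bits (M b))
                         (exec p f pc.+1 (upd M r (M a + M b)))
    | ISub r a b => addc (1 + bits r + bits a + bits b + bits (M a) + bits (M b))
                         (exec p f pc.+1 (upd M r (M a - M b)))
    | IMul r a b => addc (1 + bits r + bits a + bits b + bits (M a) + bits (M b))
                         (exec p f pc.+1 (upd M r (M a * M b)))
    | IDiv r a b => addc (1 + bits r + bits a + bits b + bits (M a) + bits (M b))
                         (exec p f pc.+1 (upd M r (M a %/ M b)))
    | ILoad r a => addc (1 + bits r + bits a + bits (M a) + bits (M (M a)))
                        (exec p f pc.+1 (upd M r (M (M a))))
    | IStore a r => addc (1 + bits r + bits a + bits (M a) + bits (M r))
                         (exec p f pc.+1 (upd M (M a) (M r)))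
    | IJz r l => addc (1 + bits r + bits l + bits (M r))
                      (exec p f (if M r == 0 then l else pc.+1) M)
    end
  end.

Definition init_mem (inp : seq nat) : memory := fun x => nth 0 inp x.

Definition input_size (inp : seq nat) : nat := size inp + sumn (map bits inp).

Definition encode (I : PB) : seq nat :=
  [:: nV I; nP I; bud I] ++ [seq cst I j | j <- enum 'I_(nP I)] ++
  flatten [seq [seq nat_of_bool (j \in appr I i) | j <- enum 'I_(nP I)]
          | i <- enum 'I_(nV I)].

Definition decode (I : PB) (M : memory) : {set 'I_(nP I)} :=
  [set j : 'I_(nP I) | M j != 0].

(* Main.v *)
Require Import Defs.
From mathcomp Require Import all_boot all_order all_algebra.
From mathcomp Require Import zify.
Import Order.TTheory GRing.Theory Num.Theory.

(* Let D = 1 + c(P) and give each project p the single number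
   W(p) = c(p) (1 + sum_i [p in A_i] D^(i+1)). The base-D digits of W(S) are c(S)
   and u_1(S), ..., u_n(S), so MPB reduces to listing all subset sums of W, one
   witness set (a bit mask) for each, and to reading their digits. The subset sums are
   found one project at a time; a table addressed directly by the (huge) sum tells
   whether it is already known, which costs only the logarithm of the address.
   This algorithm depends neither on k nor on d: they only bound the number of
   distinct sums. With g the gcd of the costs and b, each of c(S) and the at most k
   distinct utilities is g times a number at most d m, so there are at most
   (d m + 1)^(k+1) distinct sums. *)

Set Implicit Arguments.
Unset Strict Implicit.
Unset Printing Implicit Defensive.

(** * Structured programs and their compilation *)

(** Time is logarithmic cost, so counting steps is not enough: the sums have n + 1 digits in base D
    and even serve as addresses. Each execution judgement therefore carries one bound V on all
    values written, and the cost is at most the number of steps times 1 + 5 [bits V]. D has no more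
    bits than the whole input, so the bit length of V is quadratic in the input size, while the
    number of steps is governed by the number of sums; the two estimates are multiplied only at the
    end. One witness per sum suffices because the cost and all utilities are functions of the sum. A
    sum over the first projects is also a sum over all of them (leave the others out), so a single
    count bounds every intermediate queue. The table spans an exponentially long range of addresses
    and cannot be cleared; it relies on the cells past the input being 0 at the start. Registers,
    input and answer share one memory: the input must be moved away before there is any scratch
    cell, and the answer must overwrite the registers at the very end. *)

Inductive cmd :=
| Blk of seq instr
| Seq of cmd & cmd
| If of nat & cmd
| While of nat & cmd.

(* Register 4 holds 0 throughout every loop, so [IJz 4 pc] is an unconditional jump. *)
Fixpoint compile (pc : nat) (c : cmd) : program :=
  match c with
  | Blk l => l
  | Seq c1 c2 => let x := compile pc c1 in x ++ compile (pc + size x) c2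
  | If r c1 => let x := compile pc.+1 c1 in IJz r (pc.+1 + size x) :: x
  | While r c1 =>
      let x := compile pc.+1 c1 in IJz r (pc + size x).+2 :: rcons x (IJz 4 pc)
  end.

Definition stepI (i : instr) (M : memory) : memory :=
  match i with
  | IConst r v => upd M r v
  | IAdd r a b => upd M r (M a + M b)
  | ISub r a b => upd M r (M a - M b)
  | IMul r a b => upd M r (M a * M b)
  | IDiv r a b => upd M r (M a %/ M b)
  | ILoad r a => upd M r (M (M a))
  | IStore a r => upd M (M a) (M r)
  | _ => M
  end.

(** Only constants, sums and products can exceed the values already in memory, so only they carry an
    obligation. Jumps and halts are excluded from blocks: control flow comes from [cmd] alone. *)
Definition okI (V : nat) (i : instr) (M : memory) : Prop :=
  match i with
  | IConst r v => v <= V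
  | IAdd r a b => M a + M b <= V
  | IMul r a b => M a * M b <= V
  | IJz _ _ | IHalt => False
  | _ => True
  end.

Fixpoint okl (V : nat) (l : seq instr) (M : memory) : Prop :=
  if l is i :: l' then okI V i M /\ okl V l' (stepI i M) else True.

Fixpoint runl (l : seq instr) (M : memory) : memory :=
  if l is i :: l' then runl l' (stepI i M) else M.

Definition allb (V : nat) (M : memory) : Prop := forall x, M x <= V.

(** The logarithmic cost also charges the register numbers, constants and labels written in an
    instruction; K bounds them. *)
Definition wfI (K : nat) (i : instr) : bool :=
  match i with
  | IConst r v => (r <= K) && (v <= K)
  | IAdd r a b | ISub r a b | IMul r a b | IDiv r a b =>
      [&& r <= K, a <= K & b <= K]
  | ILoad r a => (r <= K) && (a <= K)
  | IStore a r => (a <= K) && (r <= K)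
  | IJz r l => (r <= K) && (l <= K)
  | IHalt => true
  end.

(* [bs V c M n M']: c terminates from M in M' after n machine steps, and every
   value written on the way is at most V (if M is bounded by V). *)
Inductive bs (V : nat) : cmd -> memory -> nat -> memory -> Prop :=
| bs_nil M : bs V (Blk [::]) M 0 M
| bs_blk i l M n M' : okI V i M -> bs V (Blk l) (stepI i M) n M' ->
    bs V (Blk (i :: l)) M n.+1 M'
| bs_seq c1 c2 M n1 M1 n2 M2 : bs V c1 M n1 M1 -> bs V c2 M1 n2 M2 ->
    bs V (Seq c1 c2) M (n1 + n2) M2
| bs_if0 r c M : M r = 0 -> bs V (If r c) M 1 M
| bs_if1 r c M n M' : M r <> 0 -> bs V c M n M' -> bs V (If r c) M n.+1 M'
| bs_while0 r c M : M r = 0 -> bs V (While r c) M 1 M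
| bs_while1 r c M n1 M1 n2 M2 : M r <> 0 -> bs V c M n1 M1 -> M1 4 = 0 ->
    bs V (While r c) M1 n2 M2 -> bs V (While r c) M (n1 + n2).+2 M2.

Lemma upd_eq M a v : upd M a v a = v.
Proof. by rewrite /upd eqxx. Qed.

Lemma upd_ne M a v x : x <> a -> upd M a v x = M x.
Proof. by rewrite /upd; case: eqP. Qed.

Lemma allb_upd V M a v : allb V M -> v <= V -> allb V (upd M a v).
Proof. by move=> HM Hv x; rewrite /upd; case: eqP. Qed.

Lemma allb_step V i M : allb V M -> okI V i M -> allb V (stepI i M).
Proof.
move=> HM; case: i => //= *; apply: allb_upd => //.
- by rewrite (leq_trans (leq_subr _ _)).
- by rewrite (leq_trans (leq_div _ _)).
Qed.

Lemma allb_bs V c M n M' : bs V c M n M' -> allb V M -> allb V M'.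
Proof. by elim=> //; eauto using allb_step. Qed.

Lemma exec_step V K p pc i M : allb V M -> K <= V -> okI V i M -> wfI K i ->
  nth IHalt p pc = i ->
  exists2 t, t <= 1 + 5 * bits V &
    forall f, exec p f.+1 pc M = addc t (exec p f pc.+1 (stepI i M)).
Proof.
move=> HM HK Hok Hwf /= ->.
have HbM x : bits (M x) <= bits V by rewrite /bits ltnS leq_trunc_log.
have Hb x : x <= K -> bits x <= bits V.
  by move=> Hx; rewrite /bits ltnS leq_trunc_log // (leq_trans Hx).
case: i Hok Hwf => //=.
- move=> r v _ /andP[/Hb ? /Hb ?]; eexists; last (move=> f; reflexivity); lia.
- move=> r a b _ /and3P[/Hb ? /Hb ? /Hb ?]; eexists; last (move=> f; reflexivity); move: (HbM a) (HbM b); lia.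
- move=> r a b _ /and3P[/Hb ? /Hb ? /Hb ?]; eexists; last (move=> f; reflexivity); move: (HbM a) (HbM b); lia.
- move=> r a b _ /and3P[/Hb ? /Hb ? /Hb ?]; eexists; last (move=> f; reflexivity); move: (HbM a) (HbM b); lia.
- move=> r a b _ /and3P[/Hb ? /Hb ? /Hb ?]; eexists; last (move=> f; reflexivity); move: (HbM a) (HbM b); lia.
- move=> r a _ /andP[/Hb ? /Hb ?]; eexists; last (move=> f; reflexivity); move: (HbM a) (HbM (M a)); lia.
- move=> a r _ /andP[/Hb ? /Hb ?]; eexists; last (move=> f; reflexivity); move: (HbM a) (HbM r); lia.
Qed.

Definition code_at (p : program) (pc : nat) (l : program) : Prop :=
  exists p1 p2, p = p1 ++ l ++ p2 /\ size p1 = pc.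

Lemma code_at_catl p pc l1 l2 : code_at p pc (l1 ++ l2) -> code_at p pc l1.
Proof. by case=> p1 [p2 [-> <-]]; exists p1, (l2 ++ p2); rewrite -!catA. Qed.

Lemma code_at_catr p pc l1 l2 :
  code_at p pc (l1 ++ l2) -> code_at p (pc + size l1) l2.
Proof.
by case=> p1 [p2 [-> <-]]; exists (p1 ++ l1), p2; rewrite size_cat -!catA.
Qed.

Lemma code_at_cons p pc i l : code_at p pc (i :: l) ->
  nth IHalt p pc = i /\ code_at p pc.+1 l.
Proof.
move=> H; split; last by have := @code_at_catr p pc [:: i] l H; rewrite addn1.
by case: H => p1 [p2 [-> <-]]; rewrite nth_cat ltnn subnn.
Qed.

Lemma addcA s t o : addc s (addc t o) = addc (s + t) o.
Proof. by case: o => [[M u]|] //=; congr (Some (_, _)); lia. Qed.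

Lemma exec_jz V K p pc r l M : allb V M -> K <= V -> all (wfI K) p ->
  nth IHalt p pc = IJz r l ->
  exists2 t, t <= 1 + 5 * bits V &
    forall f, exec p f.+1 pc M =
              addc t (exec p f (if M r == 0 then l else pc.+1) M).
Proof.
move=> HM HK Hp Hn /=; rewrite Hn; eexists; last (move=> f; reflexivity).
have Hi : (pc < size p)%N by case: ltnP => // ?; rewrite nth_default in Hn.
have := all_nthP IHalt Hp _ Hi; rewrite Hn /= => /andP[Hr Hl].
have HbM : bits (M r) <= bits V by rewrite /bits ltnS leq_trunc_log.
have Hb x : x <= K -> bits x <= bits V.
  by move=> Hx; rewrite /bits ltnS leq_trunc_log // (leq_trans Hx).
by move: (Hb _ Hr) (Hb _ Hl) HbM; lia.
Qed.

Local Arguments exec : simpl never.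

(** Quantifying over the remaining fuel f and over the position of the code in p makes runs
    composable; in the loop case the remaining iterations restart at the same position. *)
Lemma exec_bs V K p c M n M' pc : bs V c M n M' -> allb V M -> K <= V ->
  all (wfI K) p -> code_at p pc (compile pc c) ->
  exists2 t, t <= n * (1 + 5 * bits V) &
    forall f, exec p (n + f) pc M =
              addc t (exec p f (pc + size (compile pc c)) M').
Proof.
move=> H HM HK Hp; elim: H HM pc => {c M n M'}.
- move=> M _ pc _; exists 0 => // f; rewrite /= !addn0 add0n.
  by case: exec => [[M1 t]|] //=; rewrite addn0.
- move=> i l M n M' Hok _ IH HM pc /= /code_at_cons[Hn Hc].
  have Hw : wfI K i.
    have Hi : (pc < size p)%N.
      by case: ltnP => // Hs; move: Hok; rewrite -Hn nth_default.
    by have := all_nthP IHalt Hp _ Hi; rewrite Hn.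
  have [t Ht E] := IH (allb_step HM Hok) pc.+1 Hc.
  have [t1 Ht1 E1] := exec_step HM HK Hok Hw Hn.
  exists (t1 + t); first by rewrite mulSn leq_add.
  by move=> f; rewrite addSn E1 E addcA /= addSnnS.
- move=> c1 c2 M n1 M1 n2 M2 H1 IH1 _ IH2 HM pc /= Hc.
  have [t1 Ht1 E1] := IH1 HM pc (code_at_catl Hc).
  have [t2 Ht2 E2] := IH2 (allb_bs H1 HM) _ (code_at_catr Hc).
  exists (t1 + t2); first by rewrite mulnDl leq_add.
  by move=> f; rewrite -addnA E1 E2 addcA size_cat addnA.
- move=> r c M H0 HM pc /= /code_at_cons[Hn _].
  have [t Ht E] := exec_jz HM HK Hp Hn.
  by exists t => [|f]; rewrite ?mul1n // add1n E H0 addSnnS.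
- move=> r c M n M' H0 _ IH HM pc /= /code_at_cons[Hn Hc].
  have [t Ht E] := exec_jz HM HK Hp Hn.
  have [t1 Ht1 E1] := IH HM _ Hc.
  exists (t + t1); first by rewrite mulSn leq_add.
  by move=> f; rewrite addSn E (introF eqP H0) E1 addcA addSnnS.
- move=> r c M H0 HM pc /= /code_at_cons[Hn _].
  have [t Ht E] := exec_jz HM HK Hp Hn.
  by exists t => [|f]; rewrite ?mul1n // add1n E H0 size_rcons !addnS.
- move=> r c M n1 M1 n2 M2 H0 H1 IH1 Z _ IH2 HM pc Hc0.
  have /= /code_at_cons[Hn Hc] := Hc0.
  rewrite -cats1 in Hc.
  have [t Ht E] := exec_jz HM HK Hp Hn.
  have [t1 Ht1 E1] := IH1 HM _ (code_at_catl Hc).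
  have [Hn2 _] := code_at_cons (code_at_catr Hc).
  have HM1 := allb_bs H1 HM.
  have [t2 Ht2 E2] := exec_jz HM1 HK Hp Hn2.
  have [t3 Ht3 E3] := IH2 HM1 _ Hc0.
  exists (t + (t1 + (t2 + t3))); first by lia.
  move=> f; have -> : (n1 + n2).+2 + f = (n1 + (n2 + f).+1).+1 by lia.
  by rewrite E (introF eqP H0) E1 E2 Z eqxx E3 !addcA -!addnA.
Qed.

(** * Total correctness with a bound on the number of steps *)

(** The bound [allb V M] is assumed inside the triple and is preserved by every run, so loop
    invariants need not mention it. *)
Definition wp (V : nat) (c : cmd) (M : memory) (n : nat) (Q : memory -> Prop) :=
  allb V M -> exists n' M', [/\ n' <= n, bs V c M n' M' & Q M'].

Lemma wp_blk V l M n Q : size l <= n ->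
  (allb V M -> okl V l M) -> (allb V M -> Q (runl l M)) -> wp V (Blk l) M n Q.
Proof.
move=> Hn Hok HQ HM; exists (size l), (runl l M); split=> //; last exact: HQ.
by move: (Hok HM) => {Hn HQ HM Hok}; elim: l M => [|i l IH] M /= => [_|[? ?]];
  constructor; auto.
Qed.

Lemma wp_seq V c1 c2 M n1 n2 n Q : n1 + n2 <= n ->
  wp V c1 M n1 (fun M1 => wp V c2 M1 n2 Q) -> wp V (Seq c1 c2) M n Q.
Proof.
move=> Hn H1 HM; have [m1 [M1 [L1 B1 H2]]] := H1 HM.
have [m2 [M2 [L2 B2 HQ]]] := H2 (allb_bs B1 HM).
by exists (m1 + m2), M2; split=> //; [lia|exact: bs_seq B1 B2].
Qed.

Lemma wp_if V r c M n Q : (M r <> 0 -> wp V c M n Q) -> (M r = 0 -> Q M) ->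
  wp V (If r c) M n.+1 Q.
Proof.
move=> H1 H0 HM; have [E|E] := eqVneq (M r) 0.
  by exists 1, M; split=> //; [exact: bs_if0|exact: H0].
move/eqP: E => E; have [m1 [M1 [L1 B1 HQ]]] := H1 E HM.
by exists m1.+1, M1; split=> //; exact: bs_if1.
Qed.

Lemma wp_weaken V c M n n' Q Q' : n <= n' -> wp V c M n Q ->
  (forall M', allb V M' -> Q M' -> Q' M') -> wp V c M n' Q'.
Proof.
move=> Hn H HQ HM; have [m1 [M1 [L1 B1 H1]]] := H HM.
exists m1, M1; split=> //; first exact: leq_trans L1 Hn.
by apply: HQ => //; exact: allb_bs B1 HM.
Qed.

(** All loops count register r down to 0. An iteration costs its body plus two jumps (the test and
    the way back), and the last test costs one more step. *)
Lemma wp_while V r c M N nb (I : nat -> memory -> Prop) :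
  M r = N -> I 0 M ->
  (forall i M1, i < N -> M1 r = N - i -> I i M1 ->
     wp V c M1 nb (fun M2 => [/\ M2 4 = 0, M2 r = N - i.+1 & I i.+1 M2])) ->
  wp V (While r c) M (N * nb.+2).+1 (fun M' => I N M' /\ M' r = 0).
Proof.
move=> Hr H0 Hb.
suff H k i M1 : i + k = N -> M1 r = k -> I i M1 ->
    wp V (While r c) M1 (k * nb.+2).+1 (fun M' => I N M' /\ M' r = 0).
  exact: (H N 0).
elim: k i M1 => [|k IH] i M1 Hik Hrk HI HM.
  exists 1, M1; split=> //; first exact: bs_while0.
  by split=> //; rewrite -Hik addn0.
have HiN : i < N by lia.
have Hri : M1 r = N - i by lia.
have [n1 [M2 [L1 B1 [Z E HI2]]]] := Hb i M1 HiN Hri HI HM.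
have Hi2 : i.+1 + k = N by lia.
have Hr2 : M2 r = k by lia.
have [n2 [M3 [L2 B2 H3]]] := IH i.+1 M2 Hi2 Hr2 HI2 (allb_bs B1 HM).
exists (n1 + n2).+2, M3; split=> //; first by lia.
by apply: bs_while1 B1 Z B2; lia.
Qed.

(** * Subset sums and base-D digits *)

(* [reach W j v x]: the mask x (bit p set iff p is chosen) selects a subset of the
   first j items, whose total weight is v. *)
Inductive reach (W : nat -> nat) : nat -> nat -> nat -> Prop :=
| reach0 : reach W 0 0 0
| reach_skip j v x : reach W j v x -> reach W j.+1 v x
| reach_take j v x : reach W j v x -> reach W j.+1 (v + W j) (x + 2 ^ j).

Definition bit (x j : nat) : bool := odd (x %/ 2 ^ j).

Lemma reach_mono W j m v x : j <= m -> reach W j v x -> reach W m v x.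
Proof.
by move/subnKC <-; elim: (m - j) => [|k IH] H; rewrite ?addn0 // addnS;
  apply: reach_skip; exact: IH.
Qed.

Lemma reach_lt W j v x : reach W j v x -> x < 2 ^ j.
Proof. by elim=> [|j' v' x' _ IH|j' v' x' _ IH]; rewrite // expnS; lia. Qed.

Lemma bit_small x j : x < 2 ^ j -> bit x j = false.
Proof. by rewrite /bit => /divn_small ->. Qed.

Lemma bit_addX x j i : x < 2 ^ j -> i < j -> bit (x + 2 ^ j) i = bit x i.
Proof.
move=> Hx Hi; rewrite /bit -(subnK Hi) addnS -addSn expnD divnDMl ?expn_gt0 //.
by rewrite oddD oddX addbF.
Qed.

Lemma bit_addXX x j : x < 2 ^ j -> bit (x + 2 ^ j) j.
Proof. by move=> Hx; rewrite /bit divnDr // divn_small // divnn expn_gt0. Qed.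

Lemma reach_sum W j v x : reach W j v x -> v = \sum_(i < j) bit x i * W i.
Proof.
elim=> [|j' v' x' H IH|j' v' x' H IH]; first by rewrite big_ord0.
- by rewrite big_ord_recr /= (bit_small (reach_lt H)) mul0n addn0.
- have Hx := reach_lt H.
  rewrite big_ord_recr /= (bit_addXX Hx) mul1n {1}IH; congr (_ + _).
  by apply: eq_bigr => i _; rewrite bit_addX.
Qed.

Lemma reach_le W j v x : reach W j v x -> v <= \sum_(i < j) W i.
Proof. by move/reach_sum ->; apply: leq_sum => i _; case: bit; rewrite ?mul1n. Qed.

Lemma reach_subset W (f : nat -> bool) j :
  exists x, reach W j (\sum_(i < j) f i * W i) x.
Proof.
elim: j => [|j [x IH]]; first by exists 0; rewrite big_ord0; constructor.
rewrite big_ord_recr /=; case: (f j); last first.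
  by exists x; rewrite mul0n addn0; constructor.
by exists (x + 2 ^ j); rewrite mul1n; constructor.
Qed.

Lemma digit_sum D (a : nat -> nat) n i : (forall k, k < n -> a k < D) -> i < n ->
  (\sum_(k < n) a k * D ^ k) %/ D ^ i %% D = a i.
Proof.
elim: n a i => // n IH a i Ha Hi.
have D0 : 0 < D by apply: leq_ltn_trans (Ha 0 _).
rewrite big_ord_recl expn0 muln1.
have -> : \sum_(k < n) a (lift ord0 k) * D ^ lift ord0 k =
    (\sum_(k < n) a k.+1 * D ^ k) * D.
  by rewrite big_distrl; apply: eq_bigr => k _; rewrite /= /bump /= add1n expnS; lia.
case: i Hi => [|i] Hi; first by rewrite divn1 addnC modnMDl modn_small ?Ha.
rewrite expnS divnMA addnC divnMDl // (divn_small (Ha 0 _)) // addn0.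
by rewrite (IH (fun k => a k.+1)) // => k Hk; apply: Ha.
Qed.

Lemma sum_digits_lt D (a : nat -> nat) n : (forall k, k < n -> a k < D) ->
  \sum_(k < n) a k * D ^ k < D ^ n.
Proof.
elim: n => [|n IH] Ha; first by rewrite big_ord0.
rewrite big_ord_recr /= expnS.
have H1 := Ha n (ltnSn n); have H2 := IH (fun k Hk => Ha k (ltnW Hk)).
by apply: (@leq_trans (D ^ n + a n * D ^ n)); rewrite ?ltn_add2r // -mulSn leq_mul2r H1 orbT.
Qed.

Definition weight (D : nat) (cs : nat -> nat) (ap : nat -> nat -> nat) (n j : nat) :=
  cs j + \sum_(i < n) ap i j * (cs j * D ^ i.+1).

(** This is one more than the minimum of the utility digits, so that 0 remains free to mean that no
    feasible sum has been met yet. The start value D matches the default c(P) of [egal]. *)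
Fixpoint score (D n v : nat) : nat :=
  if n is i.+1 then minn (score D i v) ((v %/ D ^ i.+1) %% D).+1 else D.

(** A minimum is determined by its lower bounds. Through them this recursion can be compared with
    the iterated [minn] of [egal], whatever the order of the voters. *)
Lemma leq_score D n v x : (x <= score D n v) =
  (x <= D) && [forall i : 'I_n, x <= ((v %/ D ^ i.+1) %% D).+1].
Proof.
elim: n => [|n IH] /=.
  by rewrite (introT forallP) ?andbT // => -[].
rewrite leq_min IH -andbA; congr (_ && _); apply/andP/forallP.
- move=> [/forallP H1 H2] i; case: (unliftP ord_max i) => [j|] -> //.
  by have := H1 j; rewrite lift_max.
- move=> H; split; last exact: (H ord_max).
  by apply/forallP => i; have := H (lift ord_max i); rewrite lift_max.
Qed.

Lemma leq_bigminn n (F : 'I_n -> nat) z x :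
  (x <= \big[minn/z]_(i < n) F i) = (x <= z) && [forall i, x <= F i].
Proof.
elim: n F => [|n IH] F.
  by rewrite big_ord0 (introT forallP) ?andbT // => -[].
rewrite big_ord_recl leq_min IH andbCA; congr (_ && _); apply/andP/forallP.
- by move=> [H1 /forallP H2] i; case: (unliftP ord0 i) => [j|] ->.
- by move=> H; split; last apply/forallP.
Qed.

Lemma leq_ext a b : (forall x, (x <= a) = (x <= b)) -> a = b.
Proof. by move=> H; apply/eqP; rewrite eqn_leq -H leqnn H leqnn. Qed.

(** * Reading the encoded instance, and the digits of W(S) *)

Definition in_cost (inp : seq nat) (j : nat) : nat := nth 0 inp (3 + j).
Definition in_appr (inp : seq nat) (m i j : nat) : nat :=
  nth 0 inp (3 + m + i * m + j).

Lemma nth_flatten_uniform m (ss : seq (seq nat)) i j :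
  all (fun s => size s == m) ss -> i < size ss -> j < m ->
  nth 0 (flatten ss) (i * m + j) = nth 0 (nth [::] ss i) j.
Proof.
elim: ss i => // s ss IH [|i] /= /andP[/eqP Hs Hss] Hi Hj.
  by rewrite nth_cat Hs Hj.
by rewrite nth_cat Hs mulSn -addnA ltnNge leq_addr /= addKn IH.
Qed.

Section Instance.
Variable I : PB.
Notation n := (nV I).
Notation m := (nP I).
Notation inp := (encode I).
Notation cs := (in_cost inp).
Notation ap := (in_appr inp m).

Lemma in_costE (p : 'I_m) : cs p = cst I p.
Proof.
rewrite /in_cost /= add0n nth_cat size_map size_enum_ord ltn_ord.
by rewrite (nth_map p) ?size_enum_ord // nth_ord_enum.
Qed.

Lemma in_apprE (i : 'I_n) (p : 'I_m) : ap i p = (p \in appr I i).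
Proof.
rewrite /in_appr -!addnA /= add0n nth_cat size_map size_enum_ord ltnNge leq_addr /=.
rewrite addKn nth_flatten_uniform //; last by rewrite size_map size_enum_ord.
- rewrite (nth_map i) ?size_enum_ord // (nth_map p) ?size_enum_ord //.
  by rewrite !nth_ord_enum.
- by apply/allP => s /mapP[x _ ->]; rewrite size_map size_enum_ord.
Qed.

Lemma size_encode : size inp = 3 + m + n * m.
Proof.
rewrite /= size_cat size_map size_enum_ord size_flatten.
rewrite /shape -map_comp (eq_map (g := fun=> m)).
  have -> (s : seq 'I_n) : sumn [seq m | _ <- s] = size s * m.
    by elim: s => //= x s ->; rewrite mulSn.
  by rewrite size_enum_ord; lia.
by move=> x /=; rewrite size_map size_enum_ord.
Qed.

Definition mask_set (x : nat) : {set 'I_m} := [set j : 'I_m | bit x j].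

Lemma costS_sum (S : {set 'I_m}) : costS S = \sum_(p < m) (p \in S) * cs p.
Proof.
rewrite /costS big_mkcond; apply: eq_bigr => p _.
by rewrite in_costE; case: (p \in S); rewrite ?mul1n.
Qed.

Lemma costS_lt (S : {set 'I_m}) : costS S < (costS [set: 'I_m]).+1.
Proof.
by rewrite ltnS !costS_sum; apply: leq_sum => p _; rewrite inE leq_mul2r leq_b1 orbT.
Qed.

Notation D := (costS [set: 'I_m]).+1.
Notation W := (weight D cs ap n).

Definition digit (S : {set 'I_m}) (k : nat) : nat :=
  if k is i.+1 then \sum_(p < m) (p \in S) * (ap i p * cs p) else costS S.

Lemma digit_util (S : {set 'I_m}) (i : 'I_n) : digit S i.+1 = util i S.
Proof.
rewrite /= /util costS_sum; apply: eq_bigr => p _.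
by rewrite in_apprE in_setI mulnA mulnb.
Qed.

Lemma digit_lt (S : {set 'I_m}) k : k < n.+1 -> digit S k < D.
Proof.
case: k => [|i] Hi; first exact: costS_lt.
by rewrite (digit_util S (Ordinal (Hi : i < n))); apply: costS_lt.
Qed.

Definition set_value (S : {set 'I_m}) : nat := \sum_(k < n.+1) digit S k * D ^ k.

Lemma set_valueE (S : {set 'I_m}) : \sum_(p < m) (p \in S) * W p = set_value S.
Proof.
rewrite /set_value big_ord_recl /= expn0 muln1 (costS_sum S).
under eq_bigr do rewrite /weight mulnDr.
rewrite big_split /=; congr (_ + _).
under eq_bigr do rewrite big_distrr /=.
rewrite exchange_big /=; apply: eq_bigr => i _.
rewrite big_distrl /=; apply: eq_bigr => p _.
by rewrite /bump /= add1n !mulnA.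
Qed.

Lemma set_value_digit (S : {set 'I_m}) k : k < n.+1 -> set_value S %/ D ^ k %% D = digit S k.
Proof. by move=> Hk; rewrite digit_sum // => i Hi; apply: digit_lt. Qed.

Lemma reach_mask v x : reach W m v x -> v = set_value (mask_set x).
Proof.
move/reach_sum => ->; rewrite -set_valueE; apply: eq_bigr => p _.
by rewrite inE.
Qed.

Lemma reach_set (S : {set 'I_m}) : exists x, reach W m (set_value S) x.
Proof.
pose f j := [exists p : 'I_m, (val p == j) && (p \in S)].
have [x Hx] := reach_subset W f m; exists x.
suff -> : set_value S = \sum_(i < m) f i * W i by [].
rewrite -set_valueE; apply: eq_bigr => p _; congr (nat_of_bool _ * _).
apply/idP/existsP => [Hp|[q /andP[/eqP/val_inj -> //]]].
by exists p; rewrite eqxx.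
Qed.

Lemma score_egal (S : {set 'I_m}) : score D n (set_value S) = (egal S).+1.
Proof.
apply: leq_ext => -[|x]; first by rewrite !leq0n.
rewrite leq_score !ltnS /egal leq_bigminn; congr (_ && _).
apply: eq_forallb => i; rewrite set_value_digit ?ltnS //.
by rewrite digit_util.
Qed.

Lemma set_value_mod (S : {set 'I_m}) : set_value S %% D = costS S.
Proof. by have := @set_value_digit S 0 isT; rewrite expn0 divn1. Qed.

Lemma best_mask_solution v x : reach W m v x -> v %% D <= bud I ->
  (forall v' x', reach W m v' x' -> v' %% D <= bud I ->
     score D n v' <= score D n v) ->
  mpb_solution (mask_set x).
Proof.
move=> /reach_mask Hv; rewrite Hv set_value_mod => Hf Hopt; split=> // T HT.
have [x' Hx'] := reach_set T.
have := Hopt _ _ Hx'; rewrite set_value_mod => /(_ HT).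
by rewrite !score_egal.
Qed.

Lemma set_value_lt (S : {set 'I_m}) : set_value S < D ^ n.+1.
Proof. by apply: sum_digits_lt => k Hk; apply: digit_lt. Qed.

Lemma sum_weight_lt : \sum_(j < m) W j < D ^ n.+1.
Proof.
apply: leq_ltn_trans (set_value_lt [set: 'I_m]); rewrite -set_valueE.
by apply: leq_sum => p _; rewrite inE mul1n.
Qed.

(** * Counting the reachable sums *)

Section Count.
Variables k d : nat.
Hypothesis few_votes : distinct_votes I <= k.
Hypothesis small_limit : (scalable_limit I <= d%:R)%R.

Let g := gcdn (\big[gcdn/0]_(p : 'I_m) cst I p) (bud I).

Lemma dvd_cost p : g %| cst I p.
Proof.
by rewrite /g; apply: dvdn_trans (dvdn_gcdl _ _) _; rewrite (bigD1 p) //= dvdn_gcdl.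
Qed.

Lemma cost_le p : cst I p <= d * g.
Proof.
(* If g = 0, the quotient in the scalable limit is 0 by convention and bounds nothing, but g divides
   every cost, so all costs are 0. *)
have [g0|g0] := posnP g.
  by have := dvd_cost p; rewrite g0 dvd0n => /eqP ->.
have := small_limit; rewrite /scalable_limit -/g ler_pdivrMr ?ltr0n //.
rewrite -natrM ler_nat; apply: leq_trans.
exact: (leq_bigmax p).
Qed.

Lemma dvd_costS (S : {set 'I_m}) : g %| costS S.
Proof. by apply: dvdn_sum => p _; apply: dvd_cost. Qed.

Lemma costS_div_le (S : {set 'I_m}) : costS S %/ g < (d * m).+1.
Proof.
have [->|g0] := posnP g; first by rewrite divn0.
rewrite ltnS leq_divLR ?dvd_costS //.
rewrite costS_sum (@leq_trans (\sum_(p < m) d * g)) //.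
  by apply: leq_sum => p _; rewrite in_costE; case: (p \in S); rewrite ?mul1n ?cost_le.
by rewrite sum_nat_const card_ord; lia.
Qed.

Let vote (i : nat) := nth [set: 'I_m] (enum [set appr I i | i : 'I_n]) i.

(* The coordinate k (past the list of votes) is the cost. *)
Definition value_key (S : {set 'I_m}) : {ffun 'I_k.+1 -> 'I_(d * m).+1} :=
  [ffun i : 'I_k.+1 => inord (costS (S :&: vote i) %/ g)].

(** Each digit is the cost of S cut with a vote, or of S itself (the default [[set: 'I_m]] past the
    list of votes). Division by g loses nothing because g divides all these costs, and voters with
    equal approval sets share a coordinate. *)
Lemma value_key_inj (S T : {set 'I_m}) : value_key S = value_key T -> set_value S = set_value T.
Proof.
move=> /ffunP H.
have E (i : 'I_k.+1) : costS (S :&: vote i) = costS (T :&: vote i).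
  have := H i; rewrite !ffunE => /(congr1 val) /=.
  rewrite !inordK ?costS_div_le // => /(congr1 (muln^~ g)).
  by rewrite !divnK ?dvd_costS.
have sz : size (enum [set appr I i | i : 'I_n]) <= k by rewrite -cardE.
have E0 : costS S = costS T.
  by have := E ord_max; rewrite /vote /= nth_default // !setIT.
apply: eq_bigr => -[[|i] Hi] _; congr (_ * _) => //.
rewrite (digit_util S (Ordinal (Hi : i < n))) (digit_util T (Ordinal (Hi : i < n))) /util.
set A := appr I _.
have HA : A \in enum [set appr I i | i : 'I_n] by rewrite mem_enum imset_f.
have Hk : index A (enum [set appr I i | i : 'I_n]) < k.+1.
  by rewrite ltnS (leq_trans _ sz) // ltnW // index_mem.
by have := E (Ordinal Hk); rewrite /vote /= nth_index.
Qed.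

Lemma reachable_count (q : seq nat) : uniq q ->
  (forall v, v \in q -> exists x, reach W m v x) ->
  size q <= (d * m).+1 ^ k.+1.
Proof.
move=> Uq Hq.
have {}Hq v : v \in q -> [exists S : {set 'I_m}, set_value S == v].
  by move=> /Hq[x /reach_mask Hx]; apply/existsP; exists (mask_set x); rewrite -Hx.
pose F v := odflt set0 [pick S : {set 'I_m} | set_value S == v].
have HF v : v \in q -> set_value (F v) = v.
  by move=> /Hq/existsP[S HS]; rewrite /F; case: pickP => [T /eqP //|/(_ S)]; rewrite HS.
have U : uniq [seq value_key (F v) | v <- q].
  rewrite map_inj_in_uniq // => v w Hv Hw /value_key_inj.
  by rewrite !HF.
rewrite -(size_map (fun v => value_key (F v)) q) -(card_uniqP U).
by rewrite (leq_trans (max_card _)) // card_ffun !card_ord.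
Qed.

End Count.

(** * Size of the numbers in terms of the input size *)

Notation N := (input_size inp).

Lemma lt_bits x : x < 2 ^ bits x.
Proof. exact: trunc_log_ltn. Qed.

Lemma nth_input_lt i : nth 0 inp i < 2 ^ N.
Proof.
have [Hi|Hi] := ltnP i (size inp); last by rewrite nth_default ?expn_gt0.
apply: leq_trans (lt_bits _) _; rewrite leq_exp2l // /input_size.
rewrite (leq_trans _ (leq_addl _ _)) // sumnE big_map.
by rewrite (big_nth 0) big_mkord (bigD1 (Ordinal Hi)) //= leq_addr.
Qed.

(** A sum of numbers is smaller than the product of the powers 2^bits, so the total cost, and not
    only each single cost, fits into the bits of the input. *)
Lemma costS_setT_lt : D <= 2 ^ N.
Proof.
have H (s : seq nat) : sumn s < 2 ^ (sumn (map bits s)).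
  elim: s => // x s IH /=; rewrite expnD.
  by have := lt_bits x; move: IH; move: (2 ^ _) (2 ^ _) => a b; nia.
apply: leq_trans (_ : (sumn inp).+1 <= _); last first.
  by apply: leq_trans (H _) _; rewrite leq_exp2l // /input_size leq_addl.
rewrite ltnS /encode !sumn_cat; apply: leq_trans (leq_addl _ _).
rewrite (leq_trans _ (leq_addr _ _)) // sumnE big_map big_enum /costS.
by rewrite [X in X <= _](eq_bigl predT) // => p; rewrite inE.
Qed.

End Instance.

(** * Moving the input out of the registers *)

Lemma wp_then V c1 c2 M n1 n2 n P Q : n1 + n2 <= n -> wp V c1 M n1 P ->
  (forall M1, allb V M1 -> P M1 -> wp V c2 M1 n2 Q) -> wp V (Seq c1 c2) M n Q.
Proof.
move=> Hn H1 H2; apply: (wp_seq Hn); apply: wp_weaken (leqnn _) H1 _ => M1 HA HP.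
exact: H2.
Qed.

(** This is straight-line code with explicit register numbers, because a loop would need a counter:
    register 2 is the only free one, once b has been saved in cell B. *)
Definition save_low_regs (rs : seq nat) : program :=
  flatten [seq [:: IConst 2 r; IAdd 2 2 0; IStore 2 r] | r <- rs].

(* With B = 8 (n + 4) m, larger than every input address, the scratch registers are
   freed without any: n is recovered as B / (8 m) - 4. *)
Definition prologue : cmd :=
  Seq (Blk [:: IMul 0 0 1; IAdd 0 0 1; IAdd 0 0 1; IAdd 0 0 1; IAdd 0 0 1])
  (Seq (Blk [:: IAdd 0 0 0; IAdd 0 0 0; IAdd 0 0 0; IStore 0 2])
  (Seq (Blk (save_low_regs (iota 3 29)))
  (Seq (Blk [:: IConst 4 0; IConst 5 1; ILoad 3 0; IConst 6 8; IMul 6 6 1;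
                IDiv 2 0 6; IConst 6 4; ISub 2 2 6; IMul 10 2 1; IAdd 10 10 1;
                IConst 6 29; ISub 10 10 6; IConst 11 32; IAdd 12 11 0])
       (While 10 (Blk [:: ILoad 13 11; IStore 12 13; IAdd 11 11 5; IAdd 12 12 5;
                          ISub 10 10 5]))))).

Lemma upd_eqE M a v x : upd M a v x = if x == a then v else M x.
Proof. by []. Qed.

Definition tgtI (i : instr) (M : memory) : nat :=
  match i with
  | IConst r _ | IAdd r _ _ | ISub r _ _ | IMul r _ _ | IDiv r _ _ | ILoad r _ => r
  | IStore a _ => M a
  | _ => 0
  end.

Definition valI (i : instr) (M : memory) : nat :=
  match i with
  | IConst _ v => v
  | IAdd _ a b => M a + M b
  | ISub _ a b => M a - M b
  | IMul _ a b => M a * M b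
  | IDiv _ a b => M a %/ M b
  | ILoad _ a => M (M a)
  | IStore _ r => M r
  | _ => 0
  end.

Lemma wp_nil V M n (Q : memory -> Prop) : Q M -> wp V (Blk [::]) M n Q.
Proof. by move=> HQ HM; exists 0, M; split=> //; constructor. Qed.

(* The written value is abstracted into a variable: substituting it eagerly makes the
   symbolic memory exponentially large. *)
Lemma wp_step V i l M n (Q : memory -> Prop) :
  okI V i M ->
  (forall v, v = valI i M -> v <= V -> wp V (Blk l) (upd M (tgtI i M) v) n Q) ->
  wp V (Blk (i :: l)) M n.+1 Q.
Proof.
move=> Hok H HM.
have Hs : stepI i M = upd M (tgtI i M) (valI i M) by case: i Hok {H}.
have HA := allb_step HM Hok.
have Hv : valI i M <= V by have := HA (tgtI i M); rewrite Hs upd_eq.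
have [n' [M' [L1 B1 HQ]]] : exists n' M', [/\ n' <= n, bs V (Blk l) (stepI i M) n' M' & Q M'].
  by rewrite Hs; apply: (H _ erefl Hv); rewrite -Hs.
by exists n'.+1, M'; split=> //; constructor.
Qed.

Ltac step v H := apply: wp_step; [rewrite /= ?upd_eqE /= | move=> v; rewrite /= ?upd_eqE /= => H ?].

Ltac upds := rewrite ?upd_eqE /=; repeat (case: eqP => //= ?; try lia).

Section Prologue.
Variables (n m b V : nat) (inp : seq nat).
Hypothesis m_gt0 : 0 < m.

(** Since m > 0, (n + 4) m is at least the input length L, and the factor 8 brings it to at least
    32, above all registers. One product and repeated additions in register 0 compute it without any
    constant. *)
Definition base_addr : nat := 8 * ((n + 4) * m).
Notation B := base_addr.
Definition table_addr : nat := B + B.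
Notation E := table_addr.
Notation L := (3 + m + n * m).
Hypothesis V_addr : E + 64 <= V.

Lemma base_ge : [/\ 32 <= B, L <= B, m <= B, E = B + B & E + 64 <= V].
Proof. by split=> //; rewrite /base_addr; nia. Qed.

Record base (M : memory) : Prop := Base {
  base_B : M 0 = B; base_m : M 1 = m; base_n : M 2 = n; base_b : M 3 = b;
  base_0 : M 4 = 0; base_1 : M 5 = 1;
  base_inp : forall x, 3 <= x < L -> M (B + x) = nth 0 inp x }.

Lemma base_frame M M' : base M ->
  (forall x, x < 6 -> M' x = M x) -> (forall x, B <= x < E -> M' x = M x) -> base M'.
Proof.
have [B1 B2 B3 B4 B5] := base_ge.
move=> [? ? ? ? ? ? Hi] H6 HB; constructor; rewrite ?H6 //.
by move=> x Hx; rewrite HB; [exact: Hi|lia].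
Qed.

Lemma base_addrE : B = 8 * (n * m) + 32 * m.
Proof. by rewrite /base_addr mulnDl mulnDr (mulnA 8 4). Qed.

Lemma save_low_regs_spec rs M : allb V M -> M 0 = B -> all (fun r => 2 < r < 32) rs ->
  okl V (save_low_regs rs) M /\
  forall x, x <> 2 -> runl (save_low_regs rs) M x =
    if (x \in [seq B + r | r <- rs]) then M (x - B) else M x.
Proof.
have [B1 B2 B3 B4 B5] := base_ge.
elim: rs M => [|r rs IH] M HM M0 //= /andP[Hr Hrs].
rewrite !upd_eqE /= M0.
set M1 := upd (upd (upd M 2 r) 2 (r + B)) (r + B) _.
have E1 : M1 = upd (upd (upd M 2 r) 2 (r + B)) (r + B) (M r).
  by rewrite /M1; congr (upd _ _ _); upds.
have HM1 : allb V M1.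
  rewrite E1; apply: allb_upd (HM _); apply: allb_upd; last by lia.
  by apply: allb_upd => //; lia.
have [|Hok Hrun] := IH M1 HM1 _ Hrs.
  by rewrite E1 !upd_eqE; upds.
split.
  by do ! split=> //; lia.
move=> x Hx; rewrite Hrun // inE.
have -> : M1 x = if x == B + r then M r else M x.
  by rewrite E1 !upd_eqE addnC; upds.
case: ifP => Hin; last by rewrite orbF; case: eqP => // ->; rewrite addKn.
rewrite orbT E1 !upd_eqE.
have /mapP[y Hy ->] := Hin; rewrite addKn.
by have := allP Hrs _ Hy; upds.
Qed.

(** The initial memory vanishes past the input; this is what initialises the table for free. *)
Definition zero_from (a : nat) (M : memory) : Prop := forall x, a <= x -> M x = 0.

Hypothesis inp0 : nth 0 inp 0 = n.
Hypothesis inp1 : nth 0 inp 1 = m.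
Hypothesis inp2 : nth 0 inp 2 = b.
Hypothesis size_inp : size inp = L.

(** 110 = 5 + 4 + 87 + 14 counts the straight-line blocks, with 87 = 3 * 29 for the saved registers;
    an iteration of the copying loop has five instructions and two jumps. *)
Lemma prologue_spec M0 : (forall x, M0 x = nth 0 inp x) ->
  wp V prologue M0 (110 + (L * 7).+1)
    (fun M => base M /\ zero_from E M).
Proof.
have [B1 B2 B3 B4 B5] := base_ge; have BE := base_addrE.
move=> HM.
have [H0 H1 H2] : [/\ M0 0 = n, M0 1 = m & M0 2 = b] by rewrite !HM.
pose P1 M := [/\ M 0 = B, M 1 = m, M B = b,
  (forall x, 2 < x < B -> M x = nth 0 inp x) & zero_from B.+1 M].
apply: (@wp_then _ _ _ _ 5 (105 + (L * 7).+1) _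
  (fun M => M 0 = (n + 4) * m /\ forall x, 0 < x -> M x = M0 x)); first by lia.
  apply: wp_blk => [//|HA|HA]; rewrite /= ?upd_eqE /= ?H0 ?H1.
    by repeat split; rewrite ?(mulnC m n); lia.
  by split=> [|x Hx]; [lia|upds].
move=> M1 _ [R0 HM1].
apply: (@wp_then _ _ _ _ 4 (101 + (L * 7).+1) _ P1); first by lia.
  have R1 : M1 1 = m by rewrite HM1.
  have R2 : M1 2 = b by rewrite HM1.
  apply: wp_blk => [//|HA|HA]; rewrite /= ?upd_eqE /= ?R0.
    by repeat split; lia.
  have -> : (n + 4) * m + (n + 4) * m + ((n + 4) * m + (n + 4) * m) +
    ((n + 4) * m + (n + 4) * m + ((n + 4) * m + (n + 4) * m)) = B by lia.
  split.
  - by upds.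
  - by upds.
  - by rewrite upd_eq.
  - by move=> x Hx; upds; rewrite HM1 ?HM //; lia.
  - move=> x Hx; upds; have -> : M1 x = M0 x by apply: HM1; lia.
    by rewrite HM nth_default // size_inp; lia.
move=> {R0 HM1 M1} M1 HA1 [R0 R1 RB Rin Rz].
pose P2 M := [/\ M 0 = B, M 1 = m, M B = b,
  (forall x, 2 < x < 32 -> M (B + x) = nth 0 inp x) &
  (forall x, 31 < x < B -> M x = nth 0 inp x) /\ zero_from (B + 32) M].
apply: (@wp_then _ _ _ _ 87 (14 + (L * 7).+1) _ P2); first by lia.
  have [Hok Hrun] := save_low_regs_spec (rs := iota 3 29) HA1 R0 isT.
  apply: wp_blk => // _.
  have Hmem x : (x \in [seq B + r | r <- iota 3 29]) = (B + 2 < x < B + 32).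
    apply/mapP/idP => [[y]|Hx]; first by rewrite mem_iota => Hy ->; lia.
    by exists (x - B); rewrite ?mem_iota; lia.
  have {}Hrun x : x <> 2 -> runl (save_low_regs (iota 3 29)) M1 x =
      if B + 2 < x < B + 32 then M1 (x - B) else M1 x.
    by move=> Hx; rewrite Hrun // Hmem.
  split.
  - by rewrite Hrun //; case: ifP; lia.
  - by rewrite Hrun //; case: ifP; lia.
  - by rewrite Hrun; [case: ifP; lia|lia].
  - move=> x Hx; rewrite Hrun; last by lia.
    by case: ifP => [_|]; [rewrite addKn Rin; lia|lia].
  - split=> x Hx; rewrite Hrun; try (by move: Hx; lia).
    + by case: ifP => [|_]; [lia|apply: Rin; lia].
    + by case: ifP => [|_]; [lia|apply: Rz; lia].
move=> {R0 R1 RB Rin Rz HA1} M2 HA2 [R0 R1 RB Rlow [Rin Rz]].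
pose P3 i M := [/\ [/\ M 0 = B, M 1 = m, M 2 = n, M 3 = b & M 4 = 0],
  [/\ M 5 = 1, M 11 = 32 + i & M 12 = B + 32 + i],
  (forall x, 2 < x < 32 + i -> M (B + x) = nth 0 inp x),
  (forall x, 31 < x < B -> M x = nth 0 inp x) & zero_from (B + 32 + i) M].
apply: (@wp_then _ _ _ _ 14 (L * 7).+1 _ (fun M => P3 0 M /\ M 10 = L - 32)).
- by lia.
- have En : B %/ (8 * m) - 4 = n.
    by rewrite /base_addr mulnCA mulnK ?muln_gt0 // addnK.
  have HV x : x <= 64 -> x <= V by lia.
  step v4 E4; first exact: HV.
  step v5 E5; first exact: HV.
  step v3 E3 => //.
  have {}E3 : v3 = b by rewrite E3 R0; upds.
  step v6 E6; first exact: HV.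
  step v6' E6'; first by rewrite E6 R1; lia.
  step v2 E2 => //.
  step v6'' E6''; first exact: HV.
  step v2' E2' => //.
  have {}E2' : v2' = n by rewrite E2' E2 E6'' E6' E6 R0 R1.
  move: E2 E6' E6 E6'' => _ _ _ _.
  step v10 E10; first by rewrite E2' R1; lia.
  have {}E10 : v10 = n * m by rewrite E10 E2' R1.
  step v10' E10'; first by rewrite E10 R1; lia.
  step w6 F6; first exact: HV.
  step v10'' E10'' => //.
  have {}E10'' : v10'' = L - 32 by rewrite E10'' E10' F6 E10 R1; lia.
  move: E10 E10' F6 => _ _ _.
  step v11 E11; first exact: HV.
  step v12 E12; first by rewrite E11 R0; lia.
  have {}E12 : v12 = B + 32 by rewrite E12 E11 R0; lia.
  apply: wp_nil; split; last by upds.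
  split; [by split; rewrite ?upd_eqE|by split; rewrite ?upd_eqE /=; lia| | |].
  + by move=> x Hx; rewrite !upd_ne ?Rlow //; lia.
  + by move=> x Hx; upds; rewrite Rin.
  + by move=> x Hx; upds; rewrite Rz; lia.
move=> M3 HA3 [HP Hc].
apply: (@wp_weaken _ _ _ ((L - 32) * 7).+1 _ (fun M => P3 (L - 32) M /\ M 10 = 0)).
- by lia.
- apply: wp_while => // i M4 Hi Hc4 [[Q0 Q1 Q2 Q3 Q4] [Q5 Q11 Q12] Qlow Qin Qz].
  step v13 E13 => //.
  step v12 E12 => //.
  step v11 E11; first by upds; lia.
  step w12 F12; first by upds; lia.
  step v10 E10 => //.
  apply: wp_nil.
  have Q12' : M4 12 > 31 by lia.
  split; rewrite ?upd_eqE /=; try by move: E10; upds.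
  split.
  + by split; upds.
  + by split; upds; move: E11 F12; upds.
  + move=> x Hx; upds; last by rewrite Qlow; lia.
    by rewrite E12 E13 Q11 Qin; [congr nth; lia|lia].
  + by move=> x Hx; upds; rewrite Qin.
  + by move=> x Hx; upds; rewrite Qz; lia.
move=> M5 HA5 [[[Q0 Q1 Q2 Q3 Q4] [Q5 Q11 Q12] Qlow Qin Qz] _]; split.
  by constructor=> // x Hx; apply: Qlow; lia.
by move=> x Hx; apply: Qz; lia.
Qed.
End Prologue.

(** * Listing the subset sums *)

Record dp_full (W : nat -> nat) (j : nat) (q : seq nat) (T : memory) : Prop := DpFull {
  full_uniq : uniq q;
  full_reach : forall v, v \in q -> exists2 x, reach W j v x & T v = x.+1;
  full_zero : forall v, v \notin q -> T v = 0;
  full_all : forall v x, reach W j v x -> v \in q }.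

(* Item j has been added to the first i of the old values q0. *)
Record dp_part (W : nat -> nat) (j i : nat) (q0 q : seq nat) (T : memory) : Prop :=
  DpPart {
  part_uniq : uniq q;
  part_reach : forall v, v \in q -> exists2 x, reach W j.+1 v x & T v = x.+1;
  part_zero : forall v, v \notin q -> T v = 0;
  part_prefix : exists s, q = q0 ++ s;
  part_old : forall v, v \in q0 -> exists2 x, reach W j v x & T v = x.+1;
  part_new : forall l, l < i -> nth 0 q0 l + W j \in q }.

Lemma dp_part0 W j q T : dp_full W j q T -> dp_part W j 0 q q T.
Proof.
case=> Hu Hr Hz Ha; constructor=> //.
- by move=> v /Hr[x Hx ->]; exists x => //; constructor.
- by exists [::]; rewrite cats0.
Qed.

Lemma dp_part_seen W j i q0 q T : dp_part W j i q0 q T ->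
  T (nth 0 q0 i + W j) <> 0 -> dp_part W j i.+1 q0 q T.
Proof.
case=> Hu Hr Hz Hp Ho Hn HT; constructor=> // l.
rewrite ltnS leq_eqVlt => /orP[/eqP ->|/Hn //].
by apply/negPn/negP => /Hz.
Qed.

(** A cell is written only when it is empty, so the masks of the old values remain masks over the
    first j items, and adding 2^j to one of them never takes item j twice. *)
Lemma dp_part_new W j i q0 q T : dp_part W j i q0 q T -> i < size q0 ->
  T (nth 0 q0 i + W j) = 0 ->
  dp_part W j i.+1 q0 (rcons q (nth 0 q0 i + W j))
    (upd T (nth 0 q0 i + W j) (T (nth 0 q0 i) + 2 ^ j)).
Proof.
case=> Hu Hr Hz Hp Ho Hn Hi HT; set w := nth 0 q0 i + W j.
have Hw : w \notin q by apply/negP => /Hr[x _]; rewrite HT.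
have Hq v : v \in q -> v <> w by move=> Hv Ev; move: Hw; rewrite -Ev Hv.
have [s Hs] := Hp.
have H0 v : v \in q0 -> v \in q by rewrite Hs mem_cat => ->.
constructor.
- by rewrite rcons_uniq Hw.
- move=> v; rewrite mem_rcons inE => /orP[/eqP ->|Hv].
    have [x Hx ->] := Ho _ (mem_nth 0 Hi).
    by exists (x + 2 ^ j); [constructor|rewrite upd_eq].
  by have [x Hx E] := Hr v Hv; exists x => //; rewrite upd_ne //; apply: Hq.
- move=> v; rewrite mem_rcons inE negb_or => /andP[/eqP Hv Hvq].
  by rewrite upd_ne // Hz.
- by exists (rcons s w); rewrite -rcons_cat -Hs.
- move=> v Hv; have [x Hx E] := Ho v Hv; exists x => //.
  by rewrite upd_ne //; apply: Hq; apply: H0.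
- move=> l; rewrite ltnS leq_eqVlt mem_rcons inE => /orP[/eqP ->|/Hn ->].
    by rewrite eqxx.
  by rewrite orbT.
Qed.

Lemma dp_part_end W j q0 T0 q T : dp_full W j q0 T0 ->
  dp_part W j (size q0) q0 q T -> dp_full W j.+1 q T.
Proof.
case=> _ _ _ Ha [Hu Hr Hz [s Hs] Ho Hn]; constructor=> // v x H.
inversion H as [|j' v' x' H'|j' v' x' H']; subst.
  by rewrite mem_cat (Ha _ _ H').
by have := Ha _ _ H' => /(nthP 0)[l Hl <-]; apply: Hn.
Qed.

Lemma dp_full_init W T : (forall v, T v = if v == 0 then 1 else 0) ->
  dp_full W 0 [:: 0] T.
Proof.
move=> HT; constructor=> //.
- by move=> v; rewrite inE => /eqP ->; exists 0; [constructor|rewrite HT].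
- by move=> v; rewrite inE HT => /negbTE ->.
- by move=> v x H; inversion H.
Qed.

Lemma leq_sum_ord i k (f : nat -> nat) : i <= k -> \sum_(j < i) f j <= \sum_(j < k) f j.
Proof.
move=> Hik; rewrite (big_ord_widen k f Hik) big_mkcond.
by apply: leq_sum => j _; case: ifP.
Qed.

Definition sum_costs : cmd :=
  Seq (Blk [:: IConst 6 1; IConst 12 3; IAdd 11 0 12; IAdd 10 1 4])
      (While 10 (Blk [:: ILoad 12 11; IAdd 6 6 12; IAdd 11 11 5; ISub 10 10 5])).

(** Register 7 is E, 8 the number of sums, 9 the power 2^j, 10 the number of items left, 11 the
    address of the cost of item j, and 14 the next free queue cell. The two stores record the sum 0
    with the empty mask and queue its address. *)
Definition init_table : cmd :=
  Blk [:: IAdd 7 0 0; IAdd 13 7 5; IConst 8 1; IAdd 14 13 5; IAdd 14 14 5; IConst 9 1;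
          IAdd 10 1 4; IConst 12 3; IAdd 11 0 12; IStore 7 5; IStore 13 7].

(** Register 17 runs through c_j D^(i+1), one multiplication per voter, and register 18 goes down
    column j of the approval matrix with stride m. *)
Definition item_weight : cmd :=
  Seq (Blk [:: ILoad 15 11; IAdd 16 15 4; IMul 17 15 6; IAdd 18 11 1; IAdd 19 2 4])
      (While 19 (Blk [:: ILoad 20 18; IMul 20 20 17; IAdd 16 16 20; IMul 17 17 6;
                         IAdd 18 18 1; ISub 19 19 5])).

(* Cell E + 2 v holds 0 until the sum v is reached, and then 1 + a mask of sum v;
   the cells E + 1 + 2 i queue the addresses E + 2 v of the sums reached. *)
Definition add_item_body : cmd :=
  Seq (Blk [:: ILoad 20 18; ILoad 21 20; IAdd 22 20 16; ILoad 23 22; ISub 24 5 23])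
  (Seq (If 24 (Blk [:: IAdd 24 14 4; IAdd 14 14 5; IAdd 14 14 5; IAdd 8 8 5;
                       IAdd 21 21 9; IStore 22 21; IStore 24 22]))
       (Blk [:: IAdd 18 18 5; IAdd 18 18 5; ISub 19 19 5])).

(** The weight is doubled because the queue holds addresses E + 2 v. The loop count is fixed
    beforehand at the number of old sums, so sums appended on the way are not extended by the same
    item. *)
Definition add_item : cmd :=
  Seq item_weight
  (Seq (Blk [:: IAdd 16 16 16; IAdd 19 8 4; IAdd 18 7 5])
  (Seq (While 19 add_item_body)
       (Blk [:: IAdd 11 11 5; IAdd 9 9 9; ISub 10 10 5]))).

Section Dynamic.
Variables (n m b V Smax : nat) (inp : seq nat).
Notation B := (base_addr n m).
Notation E := (table_addr n m).
Notation L := (3 + m + n * m).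
Notation base := (base n m b inp).
Notation cs := (in_cost inp).
Notation ap := (in_appr inp m).
Definition radix : nat := (\sum_(j < m) cs j).+1.
Notation D := radix.
Notation W := (weight D cs ap n).

Hypothesis m_gt0 : 0 < m.
(** The factor 4 serves the addresses E + 2 (v + W_j), where both v and W_j are below D^(n+1). The
    exponent n + 2 serves c_j D^(n+1), which [item_weight] still computes after the last voter. The
    other terms cover queue addresses, masks, b + 1 and constants. *)
Hypothesis V_big : E + 4 * D ^ n.+2 + 2 * Smax + 2 * 2 ^ m + b + 64 <= V.
Hypothesis W_lt : \sum_(j < m) W j < D ^ n.+1.
Hypothesis count_le : forall q : seq nat, uniq q ->
  (forall v, v \in q -> exists x, reach W m v x) -> size q <= Smax.

Lemma V_addr : E + 64 <= V.
Proof. by lia. Qed.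

Lemma V_const x : x <= 64 -> x <= V.
Proof. by lia. Qed.

Lemma expn_radix : D <= D ^ n.+1 /\ D ^ n.+1 <= D ^ n.+2.
Proof. by rewrite -{1}(expn1 D) !leq_pexp2l. Qed.

Lemma W_le j : j < m -> W j < D ^ n.+1.
Proof.
by move=> Hj; apply: leq_ltn_trans W_lt; rewrite (bigD1 (Ordinal Hj)) //= leq_addr.
Qed.

Lemma cs_lt j : j < m -> cs j < D.
Proof. by move=> Hj; rewrite ltnS (bigD1 (Ordinal Hj)) //= leq_addr. Qed.

Lemma base_upd_reg M r v : base M -> 5 < r -> r < 32 -> base (upd M r v).
Proof.
have [B1 B2 B3 B4 B5] := base_ge m_gt0 V_addr.
by move=> HM H1 H2; apply: (base_frame m_gt0 V_addr HM) => x Hx; apply: upd_ne; lia.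
Qed.

Lemma base_upd_hi M a v : base M -> E <= a -> base (upd M a v).
Proof.
have [B1 B2 B3 B4 B5] := base_ge m_gt0 V_addr.
by move=> HM H1; apply: (base_frame m_gt0 V_addr HM) => x Hx; apply: upd_ne; lia.
Qed.

Lemma zero_upd_reg M r v : zero_from E M -> r < 32 -> zero_from E (upd M r v).
Proof.
have [B1 B2 B3 B4 B5] := base_ge m_gt0 V_addr.
by move=> HM H1 x Hx; rewrite upd_ne ?HM //; lia.
Qed.

Lemma sum_costs_spec M0 : base M0 -> zero_from E M0 ->
  wp V sum_costs M0 (5 + m * 6) (fun M => [/\ base M, zero_from E M & M 6 = D]).
Proof.
move=> Hb Hz; have [B1 B2 B3 B4 B5] := base_ge m_gt0 V_addr.
have [D1 D2] := expn_radix.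
pose P i M := [/\ base M, zero_from E M, M 6 = (\sum_(j < i) cs j).+1 & M 11 = B + 3 + i].
apply: (@wp_then _ _ _ _ 4 (m * 6).+1 _ (fun M => P 0 M /\ M 10 = m)).
- by lia.
- have [H0 H1 H2 H3 H4 H5 _] := Hb.
  step v6 E6; first exact: V_const.
  step v12 E12; first exact: V_const.
  step v11 E11; first by lia.
  step v10 E10; first by lia.
  apply: wp_nil; split; last by rewrite upd_eqE /= E10 H1 H4 addn0.
  split; rewrite ?upd_eqE /=; last by lia.
  + by do ! (apply: base_upd_reg => //).
  + by do ! (apply: zero_upd_reg => //).
  + by rewrite big_ord0.
move=> {Hb Hz M0} M1 _ [HP Hc].
apply: (@wp_weaken _ _ _ (m * 6).+1 _ (fun M => P m M /\ M 10 = 0)) => //; last first.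
  by move=> M2 _ [[]].
apply: wp_while => // i M Hi Hc' [Hb Hz H6 H11].
have [H0 H1 H2 H3 H4 H5 Hinp] := Hb.
have Hs : \sum_(j < i) cs j + cs i < D.
  by have := @leq_sum_ord i.+1 m cs Hi; rewrite big_ord_recr.
step v12 E12 => //.
have {}E12 : v12 = cs i.
  by rewrite E12 H11 -addnA Hinp //; lia.
step v6 E6; first by rewrite H6 E12; move: Hs V_big D1 D2; lia.
step v11 E11; first by lia.
step v10 E10 => //.
apply: wp_nil; split; rewrite ?upd_eqE //=; first by lia.
split; rewrite ?upd_eqE /=; last by lia.
- by do ! (apply: base_upd_reg => //).
- by do ! (apply: zero_upd_reg => //).
- by rewrite E6 H6 E12 big_ord_recr addSn.
Qed.

(** Separating table and queue by parity keeps two arrays of unbounded length from colliding, so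
    [stored_table] can hold for every v. *)
Record stored (q : seq nat) (T : memory) (M : memory) : Prop := Stored {
  stored_base : base M; stored_D : M 6 = D; stored_E : M 7 = E;
  stored_table : forall v, M (E + 2 * v) = T v;
  stored_queue : forall i, i < size q -> M (E + 1 + 2 * i) = E + 2 * nth 0 q i }.

Lemma stored_upd_reg q T M r v : stored q T M -> 7 < r -> r < 32 ->
  stored q T (upd M r v).
Proof.
have [B1 B2 B3 B4 B5] := base_ge m_gt0 V_addr.
move=> [Hb H6 H7 Ht Hq] Hr1 Hr2; constructor; rewrite ?upd_ne //; try lia.
- by apply: base_upd_reg => //; lia.
- by move=> x; rewrite upd_ne //; lia.
- by move=> i Hi; rewrite upd_ne ?Hq //; lia.
Qed.

Lemma stored_push q T M w t a a' v : stored q T M ->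
  a = E + 2 * w -> a' = E + 1 + 2 * size q -> v = E + 2 * w ->
  stored (rcons q w) (upd T w t) (upd (upd M a t) a' v).
Proof.
have [B1 B2 B3 B4 B5] := base_ge m_gt0 V_addr.
move=> [Hb H6 H7 Ht Hq] -> -> ->.
constructor; try by rewrite !upd_ne //; lia.
- by do ! (apply: base_upd_hi; last by lia).
- move=> x; rewrite upd_ne; last by lia.
  by rewrite !upd_eqE eqn_add2l eqn_mul2l /= Ht.
- move=> i; rewrite size_rcons ltnS nth_rcons leq_eqVlt => /orP[/eqP ->|Hi].
    by rewrite upd_eq ltnn eqxx.
  by rewrite Hi !upd_ne ?Hq //; lia.
Qed.

Record outer (j : nat) (q : seq nat) (T : memory) (M : memory) : Prop := Outer {
  outer_stored : stored q T M; outer_8 : M 8 = size q; outer_9 : M 9 = 2 ^ j;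
  outer_10 : M 10 = m - j; outer_11 : M 11 = B + 3 + j;
  outer_14 : M 14 = E + 1 + 2 * size q }.

Lemma outer_upd_reg j q T M r v : outer j q T M -> 14 < r -> r < 32 ->
  outer j q T (upd M r v).
Proof.
move=> [Hs H8 H9 H10 H11 H14] Hr1 Hr2; constructor; rewrite ?upd_ne //; try lia.
by apply: stored_upd_reg => //; lia.
Qed.

Lemma init_table_spec M0 : base M0 -> zero_from E M0 -> M0 6 = D ->
  wp V init_table M0 11 (fun M => exists2 T, outer 0 [:: 0] T M & dp_full W 0 [:: 0] T).
Proof.
move=> Hb Hz H6; have [B1 B2 B3 B4 B5] := base_ge m_gt0 V_addr.
have [H0 H1 H2 H3 H4 H5 _] := Hb.
step v7 E7; first by lia.
step v13 E13; first by lia.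
step v8 E8; first exact: V_const.
step v14 E14; first by lia.
step w14 F14; first by lia.
step v9 E9; first exact: V_const.
step v10 E10; first by lia.
step v12 E12; first exact: V_const.
step v11 E11; first by lia.
have {}E7 : v7 = E by lia.
step a Ea => //; step c Ec => //.
have E70 : (13 == v7) = false /\ (7 == v7) = false by split; apply/eqP; lia.
have [F1 F2] := E70; rewrite F2 in Ec; rewrite F1.
apply: wp_nil; exists (fun v => if v == 0 then 1 else 0); last by apply: dp_full_init.
have Hlow x y z : x < 32 -> upd (upd z v7 a) v13 y x = z x.
  by move=> Hx; rewrite !upd_ne //; lia.
constructor; rewrite ?Hlow ?upd_eqE //=; try lia.
constructor; rewrite ?Hlow ?upd_eqE //=; try lia.
- apply: base_upd_hi; last by lia.
  apply: base_upd_hi; last by lia.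
  by do ! (apply: base_upd_reg => //).
- move=> v; rewrite upd_ne; last by lia.
  case: eqP => [->|Hv]; first by rewrite addn0 -E7 upd_eq Ea.
  rewrite upd_ne; last by lia.
  by rewrite !upd_ne; try lia; rewrite Hz; lia.
- move=> [|//] _.
  have -> : E + 1 + 2 * 0 = v13 by lia.
  rewrite /= addn0.
  by rewrite upd_eq; lia.
Qed.

Lemma item_weight_spec j q T M0 : j < m -> outer j q T M0 ->
  wp V item_weight M0 (6 + n * 8) (fun M => outer j q T M /\ M 16 = W j).
Proof.
move=> Hj Ho; have [B1 B2 B3 B4 B5] := base_ge m_gt0 V_addr.
have BE := base_addrE n m; have Hcs := cs_lt Hj; have HWj := W_le Hj.
pose w i := cs j + \sum_(k < i) ap k j * (cs j * D ^ k.+1).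
have Hw i : i <= n -> w i <= W j.
  by move=> Hi; rewrite leq_add2l; apply: (@leq_sum_ord i n (fun k => ap k j * (cs j * D ^ k.+1))).
pose P i M := [/\ outer j q T M, M 16 = w i, M 17 = cs j * D ^ i.+1 &
  M 18 = B + (3 + m + i * m + j)].
have Hpow i : i <= n -> cs j * D ^ i.+1 <= D ^ n.+2.
  move=> Hi; rewrite [X in _ <= X]expnS leq_mul ?(ltnW Hcs) //.
  by rewrite leq_pexp2l.
have [D1 D2] := expn_radix.
apply: (@wp_then _ _ _ _ 5 (n * 8).+1 _ (fun M => P 0 M /\ M 19 = n)).
- by lia.
- have [[[H0 H1 H2 H3 H4 H5 Hinp] H6 H7 Ht Hq] H8 H9 H10 H11 H14] := Ho.
  step v15 E15 => //.
  have {}E15 : v15 = cs j by rewrite E15 H11 -addnA Hinp //; lia.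
  step v16 E16; first by rewrite E15 H4; move: V_big; lia.
  step v17 E17; first by rewrite E15 H6 (leq_trans (Hpow 0 _)) //; move: V_big; lia.
  step v18 E18; first by lia.
  step v19 E19; first by rewrite H2 H4; have : n * 1 <= n * m; [rewrite leq_mul2l m_gt0 orbT|lia].
  apply: wp_nil; split; rewrite ?upd_eqE /=; last by lia.
  split; rewrite ?upd_eqE /=; try lia.
  + by do ! (apply: outer_upd_reg => //).
  + by rewrite E16 E15 H4 /w big_ord0.
move=> {Ho M0} M1 _ [HP Hc].
apply: (@wp_weaken _ _ _ (n * 8).+1 _ (fun M => P n M /\ M 19 = 0)) => //; last first.
  by move=> M2 _ [[]].
apply: wp_while => // i M Hi Hc' [Ho H16 H17 H18].
have [[[H0 H1 H2 H3 H4 H5 Hinp] H6 H7 Ht Hq] H8 H9 H10 H11 H14] := Ho.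
have Him : i.+1 * m <= n * m by rewrite leq_mul2r Hi orbT.
step v20 E20 => //.
have {}E20 : v20 = ap i j by rewrite E20 H18 Hinp //; rewrite mulSn in Him; lia.
have Hw1 : w i.+1 = w i + ap i j * (cs j * D ^ i.+1) by rewrite /w big_ord_recr addnA.
have Hw2 := Hw i.+1 Hi.
step w20 F20; first by rewrite E20 H17; move: V_big; lia.
have {}F20 : w20 = ap i j * (cs j * D ^ i.+1) by rewrite F20 E20 H17.
step v16 E16; first by rewrite H16 F20 -Hw1; move: V_big; lia.
have {}E16 : v16 = w i.+1 by rewrite E16 H16 F20.
step v17 E17.
  by rewrite H17 H6 -mulnA -expnSr (leq_trans (Hpow i.+1 Hi)) //; move: V_big; lia.
have {}E17 : v17 = cs j * D ^ i.+2 by rewrite E17 H17 H6 -mulnA -expnSr.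
have E18' : M 18 + M 1 = B + (3 + m + i.+1 * m + j) by rewrite H18 H1 mulSn; lia.
step v18 E18; first by rewrite E18'; lia.
step v19 E19 => //.
apply: wp_nil; split; rewrite ?upd_eqE //=; first by lia.
split; rewrite ?upd_eqE //=; last by lia.
by do ! (apply: outer_upd_reg => //).
Qed.

(** Leaving out the remaining items turns a sum of the first j + 1 items into a sum of all m, so the
    bound for the whole instance applies to each intermediate queue. *)
Lemma part_count j i q0 q T : j < m -> dp_part W j i q0 q T -> size q <= Smax.
Proof.
move=> Hj [Hu Hr _ _ _ _]; apply: count_le => // v /Hr[x Hx _].
by exists x; apply: reach_mono Hx.
Qed.

Lemma add_item_body_spec j i q0 M0 :
  j < m -> i < size q0 ->
  (exists q T, [/\ outer j q T M0, dp_part W j i q0 q T, M0 16 = 2 * W j &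
     M0 18 = E + 1 + 2 * i]) ->
  wp V add_item_body M0 16 (fun M => M 19 = M0 19 - 1 /\
    exists q T, [/\ outer j q T M, dp_part W j i.+1 q0 q T, M 16 = 2 * W j &
     M 18 = E + 1 + 2 * i.+1]).
Proof.
move=> Hj Hi [q [T [Ho Hp H16 H18]]].
have [B1 B2 B3 B4 B5] := base_ge m_gt0 V_addr.
have HWj := W_le Hj; have [D1 D2] := expn_radix.
have Hsz := part_count Hj Hp.
set v := nth 0 q0 i; set w := v + W j.
have [[[H0 H1 H2 H3 H4 H5 Hinp] H6 H7 Ht Hq] H8 H9 H10 H11 H14] := Ho.
have [s Hs] := part_prefix Hp.
have Hiq : i < size q by rewrite Hs size_cat; lia.
have Hqi : nth 0 q i = v by rewrite Hs nth_cat Hi.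
have [x Hx Tv] := part_old Hp (mem_nth 0 Hi); rewrite -/v in Hx Tv.
have Hv : v < D ^ n.+1.
  by apply: leq_ltn_trans W_lt; apply: reach_le (reach_mono (ltnW Hj) Hx).
have Hx2 := reach_lt Hx.
have Hjm : 2 ^ j.+1 <= 2 ^ m by rewrite leq_exp2l.
rewrite expnS in Hjm.
pose P1 M := [/\ outer j q T M, M 16 = 2 * W j, M 18 = E + 1 + 2 * i, M 19 = M0 19 &
  [/\ M 21 = T v, M 22 = E + 2 * w & M 24 = 1 - T w]].
apply: (@wp_then _ _ _ _ 5 11 _ P1); first by lia.
  step v20 E20 => //.
  have {}E20 : v20 = E + 2 * v by rewrite E20 H18 Hq // Hqi.
  step v21 E21 => //.
  have {}E21 : v21 = T v by rewrite E21 E20 Ht; upds.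
  step v22 E22; first by rewrite E20 H16; move: V_big; lia.
  have {}E22 : v22 = E + 2 * w by rewrite E22 E20 H16 /w; lia.
  step v23 E23 => //.
  have {}E23 : v23 = T w by rewrite E23 E22 Ht; upds.
  step v24 E24 => //.
  apply: wp_nil; split; rewrite ?upd_eqE //=.
    by do ! (apply: outer_upd_reg => //).
  by split=> //; rewrite E24 E23 H5.
move=> M1 _ [].
move: Ho H0 H1 H2 H3 H4 H5 Hinp H6 H7 Ht Hq H8 H9 H10 H11 H14 H16 H18.
move=> _ _ _ _ _ _ _ _ _ _ _ _ _ _ _ _ _ _ _.
move=> Ho H16 H18 H19 [H21 H22 H24].
pose P2 M := M 19 = M0 19 /\ exists q T, [/\ outer j q T M, dp_part W j i.+1 q0 q T,
  M 16 = 2 * W j & M 18 = E + 1 + 2 * i].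
apply: (@wp_then _ _ _ _ 8 3 _ P2); first by lia.
  apply: wp_if; last first.
    rewrite H24 => H0; split=> //; exists q, T; split=> //.
    by apply: dp_part_seen => //; rewrite -/v -/w; lia.
  rewrite H24 => Hne; have Tw : T w = 0 by lia.
  have := dp_part_new Hp Hi Tw; rewrite -/v -/w => Hp'.
  (* The enlarged queue again consists of distinct reachable sums, so [Smax] also covers the address
     of the cell just filled. *)
  have Hsz' := part_count Hj Hp'; rewrite size_rcons in Hsz'.
  have [Hst H8 H9 H10 H11 H14] := Ho.
  have H5 := base_1 (stored_base Hst); have H4 := base_0 (stored_base Hst).
  step v24 E24; first by move: V_big; lia.
  have {}E24 : v24 = E + 1 + 2 * size q by lia.
  step v14 E14; first by move: V_big; lia.
  step w14 F14; first by move: V_big; lia.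
  have {E14}F14 : w14 = E + 1 + 2 * (size q).+1 by lia.
  step v8 E8; first by move: V_big; lia.
  step v21 E21; first by move: V_big; lia.
  step a Ea => //; step c Ec => //.
  have Hlow M2 y : y < 32 -> upd M2 (M1 22) a y = M2 y.
    by move=> Hy; rewrite upd_ne //; lia.
  have [F1 F2] : (22 == M1 22) = false /\ (24 == M1 22) = false.
    by split; apply/eqP; lia.
  rewrite F1 in Ec; rewrite F2.
  have Hlow2 M2 y : y < 32 -> upd M2 v24 c y = M2 y.
    by move=> Hy; rewrite upd_ne //; lia.
  apply: wp_nil; split; first by rewrite Hlow2 // Hlow.
  exists (rcons q w), (upd T w (T v + 2 ^ j)); split=> //; try by rewrite Hlow2 // Hlow.
  have -> : T v + 2 ^ j = a by lia.
  constructor; rewrite ?size_rcons; try by rewrite Hlow2 // Hlow // ?upd_eqE //=; lia.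
  apply: stored_push => //; last by lia.
  by do ! (apply: stored_upd_reg => //).
move=> M2 _ [H19' [q' [T' [Ho' Hp' H16' H18']]]].
have [[[H0 H1 H2 H3 H4 H5 Hinp] H6 H7 Ht Hq] H8 H9 H10 H11 H14] := Ho'.
step v18 E18; first by move: V_big; lia.
step w18 F18; first by move: V_big; lia.
step v19 E19 => //.
apply: wp_nil; split; rewrite ?upd_eqE /=; first by lia.
exists q', T'; split; rewrite ?upd_eqE //=; last by lia.
by do ! (apply: outer_upd_reg => //).
Qed.

Lemma add_item_spec j q0 T0 M0 : j < m -> outer j q0 T0 M0 -> dp_full W j q0 T0 ->
  wp V add_item M0 (20 + n * 8 + Smax * 18)
    (fun M => exists q T, outer j.+1 q T M /\ dp_full W j.+1 q T).
Proof.
move=> Hj Ho Hf; have [B1 B2 B3 B4 B5] := base_ge m_gt0 V_addr.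
have HWj := W_le Hj; have [D1 D2] := expn_radix.
have Hs0 := part_count Hj (dp_part0 Hf).
apply: (@wp_then _ _ _ _ (6 + n * 8) (14 + Smax * 18) _ _ _ _ (item_weight_spec Hj Ho)).
  by lia.
move=> {Ho M0} M0 _ [Ho H16].
pose I i M := exists q T, [/\ outer j q T M, dp_part W j i q0 q T, M 16 = 2 * W j &
  M 18 = E + 1 + 2 * i].
apply: (@wp_then _ _ _ _ 3 (8 + Smax * 18) _ (fun M => I 0 M /\ M 19 = size q0)).
- by lia.
- have [[[H0 H1 H2 H3 H4 H5 Hinp] H6 H7 Ht Hq] H8 H9 H10 H11 H14] := Ho.
  step v16 E16; first by move: V_big; lia.
  step v19 E19; first by move: V_big; lia.
  step v18 E18; first by lia.
  apply: wp_nil; split; rewrite ?upd_eqE /=; last by lia.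
  exists q0, T0; split; rewrite ?upd_eqE /=; try lia; last exact: dp_part0.
  by do ! (apply: outer_upd_reg => //).
move=> {Ho H16 M0} M0 _ [HI Hc].
apply: (@wp_then _ _ _ _ (size q0 * 18).+1 4 _ (fun M => I (size q0) M /\ M 19 = 0)).
- by have := leq_mul Hs0 (leqnn 18); lia.
- apply: wp_while => // i M Hi Hc' HIi.
  apply: (wp_weaken (leqnn _) (add_item_body_spec Hj Hi HIi)) => M' _ [E19 HI'].
  split=> //; last by lia.
  by case: HI' => q [T [Ho _ _ _]]; exact: base_0 (stored_base (outer_stored Ho)).
move=> {HI Hc M0} M0 _ [[q [T [Ho Hp _ _]]] _].
have [[[H0 H1 H2 H3 H4 H5 Hinp] H6 H7 Ht Hq] H8 H9 H10 H11 H14] := Ho.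
have Hjm : 2 ^ j.+1 <= 2 ^ m by rewrite leq_exp2l.
rewrite expnS in Hjm.
step v11 E11; first by lia.
step v9 E9; first by move: V_big; lia.
step v10 E10 => //.
apply: wp_nil; exists q, T; split; last exact: dp_part_end Hf Hp.
constructor; rewrite ?upd_eqE //= ?expnS; try lia.
by do ! (apply: stored_upd_reg => //); case: Ho.
Qed.

Definition build_table : cmd := Seq sum_costs (Seq init_table (While 10 add_item)).

Lemma build_table_spec M0 : base M0 -> zero_from E M0 ->
  wp V build_table M0 (17 + m * (28 + n * 8 + Smax * 18))
    (fun M => exists q T, [/\ stored q T M, M 8 = size q & dp_full W m q T]).
Proof.
move=> Hb Hz.
apply: (@wp_then _ _ _ _ (5 + m * 6) (12 + m * (22 + n * 8 + Smax * 18)) _ _ _ _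
  (sum_costs_spec Hb Hz)); first by rewrite !mulnDr; lia.
move=> {Hb Hz M0} M0 _ [Hb Hz H6].
apply: (@wp_then _ _ _ _ 11 (m * (22 + n * 8 + Smax * 18)).+1 _ _ _ _
  (init_table_spec Hb Hz H6)); first by lia.
move=> {Hb Hz H6 M0} M0 _ [T Ho Hf].
pose I j M := exists q T, outer j q T M /\ dp_full W j q T.
apply: (@wp_weaken _ _ _ (m * (22 + n * 8 + Smax * 18)).+1 _ (fun M => I m M /\ M 10 = 0)).
- by [].
- apply: wp_while; first by rewrite (outer_10 Ho) subn0.
    by exists [:: 0], T.
  move=> j M Hj Hc [q [T' [Ho' Hf']]].
  apply: (wp_weaken (leqnn _) (add_item_spec Hj Ho' Hf')) => M' _ [q' [T'' [Ho'' Hf'']]].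
  split; last by exists q', T''.
  - exact: base_0 (stored_base (outer_stored Ho'')).
  - exact: outer_10 Ho''.
move=> M _ [[q [T' [Ho' Hf']]] _]; exists q, T'; split=> //.
- exact: outer_stored Ho'.
- exact: outer_8 Ho'.
Qed.

End Dynamic.

(** * Selecting the best sum and writing the answer *)

(** With truncated subtraction, a - (a - b) is the minimum of a and b; this replaces a comparison.
    Register 15 starts at v / D, that is, with the cost digit already removed. *)
Definition min_digit : cmd :=
  While 19 (Blk [:: IDiv 16 15 6; IMul 17 16 6; ISub 17 15 17; IAdd 17 17 5;
                    ISub 17 21 17; ISub 21 21 17; IAdd 15 16 4; ISub 19 19 5]).

(** Truncated differences serve as tests: (b + 1) - c(S) is nonzero exactly for feasible S, and the
    score minus the best score so far is nonzero exactly for an improvement. *)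
Definition select_body : cmd :=
  Seq (Blk [:: ILoad 20 18; ISub 15 20 7; IConst 16 2; IDiv 15 15 16; IDiv 16 15 6;
               IMul 17 16 6; ISub 17 15 17; ISub 17 25 17])
  (Seq (If 17 (Seq (Blk [:: IAdd 15 16 4; IAdd 21 6 4; IAdd 19 2 4])
              (Seq min_digit
              (Seq (Blk [:: ISub 17 21 26])
                   (If 17 (Blk [:: IAdd 26 21 4; ILoad 27 20]))))))
       (Blk [:: IAdd 18 18 5; IAdd 18 18 5; ISub 10 10 5])).

Definition select : cmd :=
  Seq (Blk [:: IAdd 25 3 5; IConst 26 0; IConst 27 0; IAdd 10 8 4; IAdd 18 7 5])
      (While 10 select_body).

(** The bits of the mask go to the cells from B on, over the copy of the input, because the answer
    cells 0, ..., m - 1 overlap the registers still in use. *)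
Definition unpack : cmd :=
  Seq (Blk [:: ISub 27 27 5; IConst 16 2; IAdd 10 1 4; IAdd 18 0 4])
      (While 10 (Blk [:: IDiv 15 27 16; IMul 17 15 16; ISub 17 27 17; IStore 18 17;
                         IAdd 27 15 4; IAdd 18 18 5; ISub 10 10 5])).

Definition copy_high : cmd :=
  Seq (Blk [:: IConst 16 32; ISub 10 1 16; IAdd 18 0 16; IAdd 11 16 4])
      (While 10 (Blk [:: ILoad 17 18; IStore 11 17; IAdd 18 18 5; IAdd 11 11 5;
                         ISub 10 10 5])).

Definition load_low_regs (rs : seq nat) : program :=
  flatten [seq [:: IConst 1 r; IAdd 1 1 0; ILoad r 1] | r <- rs].

(** The order keeps addresses computable: cells 2 to 31 are filled while register 1 is scratch, then
    cell 1, and last cell 0, which holds B until then. Register 4 is lost here, but no loop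
    follows. *)
Definition copy_low : cmd :=
  Seq (Blk (load_low_regs (iota 2 30)))
      (Blk [:: IConst 1 1; IAdd 1 1 0; ILoad 1 1; ILoad 0 0]).

(** For m = 0 the base address would be 0 and the memory layout would collapse; but then the empty
    set is the only subset, and the untouched memory already decodes to it. *)
Definition main : cmd :=
  If 1 (Seq prologue (Seq build_table (Seq select
       (Seq unpack (Seq copy_high copy_low))))).

Lemma score_gt0 D n v : 0 < D -> 0 < score D n v.
Proof. by move=> HD; rewrite leq_score HD; apply/forallP. Qed.

Lemma score_le D n v : score D n v <= D.
Proof. by elim: n => //= n IH; rewrite geq_min IH. Qed.

Lemma bit_div2 x i : x %/ 2 ^ i - x %/ 2 ^ i.+1 * 2 = bit x i.
Proof. by rewrite /bit expnSr divnMA {1}(divn_eq (x %/ 2 ^ i) 2) addKn modn2. Qed.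

Section Output.
Variables (n m b V Smax : nat) (inp : seq nat).
Notation B := (base_addr n m).
Notation E := (table_addr n m).
Notation base := (base n m b inp).
Notation cs := (in_cost inp).
Notation ap := (in_appr inp m).
Notation D := (radix m inp).
Notation W := (weight D cs ap n).
Notation stored := (stored n m b inp).

Hypothesis m_gt0 : 0 < m.
Hypothesis V_big : E + 4 * D ^ n.+2 + 2 * Smax + 2 * 2 ^ m + b + 64 <= V.
Hypothesis W_lt : \sum_(j < m) W j < D ^ n.+1.
Hypothesis count_le : forall q : seq nat, uniq q ->
  (forall v, v \in q -> exists x, reach W m v x) -> size q <= Smax.

Let addr_facts := base_ge m_gt0 (V_addr m_gt0 V_big W_lt).
Let stored_upd := stored_upd_reg m_gt0 V_big W_lt.
Let vconst := V_const m_gt0 V_big W_lt.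

Definition best_of (q : seq nat) (T : memory) (i x y : nat) : Prop :=
  (x = 0 \/ exists v, [/\ v \in q, v %% D <= b, x = score D n v & y = T v]) /\
  forall l, l < i -> nth 0 q l %% D <= b -> score D n (nth 0 q l) <= x.

Lemma best_of_skip q T i x y : best_of q T i x y ->
  (nth 0 q i %% D <= b -> score D n (nth 0 q i) <= x) -> best_of q T i.+1 x y.
Proof.
move=> [H1 H2] H; split=> // l.
by rewrite ltnS leq_eqVlt => /orP[/eqP ->|/H2].
Qed.

Lemma best_of_take q T i x y : best_of q T i x y -> i < size q ->
  nth 0 q i %% D <= b -> x < score D n (nth 0 q i) ->
  best_of q T i.+1 (score D n (nth 0 q i)) (T (nth 0 q i)).
Proof.
move=> [H1 H2] Hi Hb Hx; split.
  by right; exists (nth 0 q i); split=> //; apply: mem_nth.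
move=> l; rewrite ltnS leq_eqVlt => /orP[/eqP -> //|Hl /(H2 l Hl)] /leq_trans; apply.
exact: ltnW.
Qed.

Lemma min_digit_spec q T v M0 : stored q T M0 -> v < D ^ n.+1 ->
  M0 15 = v %/ D -> M0 21 = D -> M0 19 = n ->
  wp V min_digit M0 (n * 10).+1 (fun M => [/\ stored q T M, M 21 = score D n v &
    forall r, r \in [:: 10; 18; 20; 25; 26; 27] -> M r = M0 r]).
Proof.
move=> Hs Hv H15 H21 H19; have [B1 B2 B3 B4 B5] := addr_facts.
have [D1 D2] := expn_radix n m inp.
pose I i M := [/\ stored q T M, M 21 = score D i v, M 15 = v %/ D ^ i.+1 &
    forall r, r \in [:: 10; 18; 20; 25; 26; 27] -> M r = M0 r].
apply: (@wp_weaken _ _ _ (n * 10).+1 _ (fun M => I n M /\ M 19 = 0)) => //; last first.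
  by move=> M _ [[]].
apply: wp_while; first exact: H19.
  by split=> //; rewrite expn1.
move=> i M Hi Hc [{}Hs {}H21 {}H15 Hr].
have [[H0 H1 H2 H3 H4 H5 Hinp] H6 H7 Ht Hq] := Hs.
have Hw : M 15 <= D ^ n.+1 by rewrite H15 (leq_trans (leq_div _ _)) // ltnW.
set w := M 15 in H15 Hw.
step v16 E16 => //; rewrite -/w H6 in E16.
step v17 E17; first by rewrite E16 H6 (leq_trans (leq_trunc_div _ _)) //; move: V_big; lia.
step w17 F17 => //.
have {E17}F17 : w17 = w %% D.
  by rewrite F17 E17 E16 H6 -/w {1}(divn_eq w D) addKn.
have HwD : w %% D < D by rewrite ltn_mod.
step u17 G17; first by rewrite H5 F17; move: V_big; lia.
step x17 X17 => //.
step v21 E21 => //.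
have {X17 G17}E21 : v21 = score D i.+1 v.
  by rewrite E21 X17 G17 H5 F17 H21 addn1 /= -H15 minnE.
step v15 E15.
  have : v16 <= w by rewrite E16 leq_div.
  by move: V_big; lia.
have {}E15 : v15 = v %/ D ^ i.+2.
  by rewrite E15 H4 addn0 E16 H15 -divnMA -expnSr.
step v19 E19 => //.
apply: wp_nil; split; rewrite ?upd_eqE /=; [exact: H4|by rewrite E19 Hc H5 -subnDA addn1|].
split; rewrite ?upd_eqE //=.
  by do ! (apply: stored_upd => //).
move=> r Hr0; rewrite -Hr //; rewrite !inE in Hr0.
by rewrite !upd_ne //; move=> Er; rewrite Er in Hr0.
Qed.

Lemma select_body_spec q T i M0 : i < size q -> size q <= Smax -> stored q T M0 ->
  (forall v, v \in q -> v < D ^ n.+1) ->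
  M0 25 = b.+1 -> M0 18 = E + 1 + 2 * i -> best_of q T i (M0 26) (M0 27) ->
  wp V select_body M0 (20 + n * 10) (fun M => [/\ stored q T M, M 25 = b.+1,
    M 18 = E + 1 + 2 * i.+1, M 10 = M0 10 - 1 & best_of q T i.+1 (M 26) (M 27)]).
Proof.
move=> Hi Hsz Hs Hlt H25 H18 Hbest; have [B1 B2 B3 B4 B5] := addr_facts.
have [D1 D2] := expn_radix n m inp.
set v := nth 0 q i; have Hv : v < D ^ n.+1 by apply/Hlt/mem_nth.
pose P1 M := [/\ stored q T M, M 17 = b.+1 - v %% D, M 16 = v %/ D, M 20 = E + 2 * v &
   forall r, r \in [:: 10; 18; 25; 26; 27] -> M r = M0 r].
apply: (@wp_then _ _ _ _ 8 (12 + n * 10) _ P1); first by lia.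
  have [[H0 H1 H2 H3 H4 H5 Hinp] H6 H7 Ht Hq] := Hs.
  step v20 E20 => //.
  have {}E20 : v20 = E + 2 * v by rewrite E20 H18 Hq.
  step v15 E15 => //.
  step v16 E16; first exact: vconst.
  step w15 F15 => //.
  have {E15 E16}F15 : w15 = v.
    by rewrite F15 E15 E16 E20 H7 addKn mulKn.
  step w16 F16 => //.
  step v17 E17.
    by rewrite F16 H6 F15 (leq_trans (leq_trunc_div _ _)) //; move: V_big; lia.
  step w17 F17 => //.
  have {E17}F17 : w17 = v %% D.
    by rewrite F17 E17 F16 H6 F15 {1}(divn_eq v D) addKn.
  step x17 X17 => //.
  apply: wp_nil; split; rewrite ?upd_eqE /=.
  - by do ! (apply: stored_upd => //).
  - by rewrite X17 F17 H25.
  - by rewrite F16 H6 F15.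
  - exact: E20.
  - move=> r; rewrite !inE => Hr; rewrite !upd_ne // => Er; by rewrite Er in Hr.
move=> M1 _ [{}Hs H17 H16 H20 Hr].
pose P2 M := [/\ stored q T M, M 10 = M0 10, M 18 = M0 18, M 25 = M0 25 &
  best_of q T i.+1 (M 26) (M 27)].
apply: (@wp_then _ _ _ _ (9 + n * 10) 3 _ P2); first by lia.
  rewrite addSn; apply: wp_if; rewrite H17; last first.
    move=> Hz; split=> //; try by apply: Hr.
    rewrite !Hr //; apply: best_of_skip => //; rewrite -/v; lia.
  move=> Hne; have Hfeas : v %% D <= b by lia.
  pose P3 M := [/\ stored q T M, [/\ M 15 = v %/ D, M 21 = D & M 19 = n],
    M 20 = E + 2 * v & forall r, r \in [:: 10; 18; 25; 26; 27] -> M r = M0 r].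
  apply: (@wp_then _ _ _ _ 3 (5 + n * 10) _ P3); first by lia.
    have [[H0 H1 H2 H3 H4 H5 Hinp] H6 H7 Ht Hq] := Hs.
    step v15 E15.
      by rewrite H4 H16 addn0 (leq_trans (leq_div _ _)) //; move: V_big; lia.
    step v21 E21; first by rewrite H6 H4; move: V_big; lia.
    step v19 E19; first by rewrite H2 H4 addn0; nia.
    apply: wp_nil; split; rewrite ?upd_eqE //=.
    - by do ! (apply: stored_upd => //).
    - by split; lia.
    - move=> r Hr0; rewrite -Hr // !upd_ne // => Er; by rewrite Er in Hr0.
  move=> M2 _ [{}Hs [H15 H21 H19] {}H20 {}Hr].
  apply: (@wp_then _ _ _ _ (n * 10).+1 4 _ _ _ _ (min_digit_spec Hs Hv H15 H21 H19)).
    by lia.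
  move=> M3 _ [{}Hs {}H21 Hr'].
  have {}H20 : M3 20 = E + 2 * v by rewrite Hr'.
  have {Hr' H15 H19}Hr r : r \in [:: 10; 18; 25; 26; 27] -> M3 r = M0 r.
    move=> Hr0; rewrite -Hr // Hr' //.
    by move: Hr0; rewrite !inE => /or4P[->|->|->|/orP[->|->]]; rewrite ?orbT.
  pose P4 M := [/\ stored q T M, [/\ M 17 = score D n v - M0 26, M 21 = score D n v &
    M 20 = E + 2 * v] & forall r, r \in [:: 10; 18; 25; 26; 27] -> M r = M0 r].
  apply: (@wp_then _ _ _ _ 1 3 _ P4); first by lia.
    step v17 E17 => //.
    apply: wp_nil; split; rewrite ?upd_eqE //=.
    - by apply: stored_upd.
    - by split=> //; rewrite E17 H21 Hr.
    - move=> r Hr0; rewrite -Hr // !upd_ne // => Er; by rewrite Er in Hr0.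
  move=> {H16 H17 H20 H21 Hr Hs} M4 _ [Hs [H17 H21 H20] Hr].
  apply: wp_if; rewrite H17; last first.
    move=> Hz; split=> //; try by apply: Hr.
    rewrite !Hr //; apply: best_of_skip => // _; rewrite -/v; lia.
  move=> Hgt.
  have [[H0 H1 H2 H3 H4 H5 Hinp] H6 H7 Ht Hq] := Hs.
  step v26 E26.
    by rewrite H21 H4 addn0 (leq_trans (score_le _ _ _)) //; move: V_big; lia.
  step v27 E27 => //.
  have {}E27 : v27 = T v by rewrite E27 H20 Ht; upds.
  apply: wp_nil; split; rewrite ?upd_eqE //=; try by rewrite Hr.
    by do ! (apply: stored_upd => //).
  rewrite E27 E26 H21 H4 addn0; apply: best_of_take Hbest _ _ _ => //; rewrite -/v; lia.
move=> M2 _ [{}Hs {}H10 {}H18' {}H25' {}Hbest].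
have [[H0 H1 H2 H3 H4 H5 Hinp] H6 H7 Ht Hq] := Hs.
step v18 E18; first by move: V_big; lia.
step w18 F18; first by move: V_big; lia.
step v10 E10 => //.
apply: wp_nil; split; rewrite ?upd_eqE //=; try lia.
by do ! (apply: stored_upd => //).
Qed.

Lemma select_spec q T M0 : stored q T M0 -> M0 8 = size q -> dp_full W m q T ->
  wp V select M0 (6 + Smax * (22 + n * 10)) (fun M => base M /\
    exists v x, [/\ M 27 = x.+1, reach W m v x, v %% D <= b &
      forall v' x', reach W m v' x' -> v' %% D <= b -> score D n v' <= score D n v]).
Proof.
move=> Hs H8 [Hu Hr Hz Ha]; have [B1 B2 B3 B4 B5] := addr_facts.
have Hlt v : v \in q -> v < D ^ n.+1.
  by move=> /Hr[x Hx _]; apply: leq_ltn_trans W_lt; apply: reach_le Hx.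
have Hsz : size q <= Smax by apply: count_le => // v /Hr[x Hx _]; exists x.
pose I i M := [/\ stored q T M, M 25 = b.+1, M 18 = E + 1 + 2 * i &
  best_of q T i (M 26) (M 27)].
apply: (@wp_then _ _ _ _ 5 (Smax * (22 + n * 10)).+1 _ (fun M => I 0 M /\ M 10 = size q)).
- by lia.
- have [[H0 H1 H2 H3 H4 H5 Hinp] H6 H7 Ht Hq] := Hs.
  step v25 E25; first by move: V_big; lia.
  step v26 E26; first exact: vconst.
  step v27 E27; first exact: vconst.
  step v10 E10; first by move: V_big; lia.
  step v18 E18; first by move: V_big; lia.
  apply: wp_nil; split; rewrite ?upd_eqE /=; last by lia.
  split; rewrite ?upd_eqE /=; try lia.
    by do ! (apply: stored_upd => //).
  by split=> //; left.
move=> {Hs H8 M0} M0 _ [HI Hc].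
apply: (@wp_weaken _ _ _ (size q * (22 + n * 10)).+1 _ (fun M => I (size q) M /\ M 10 = 0)).
- by rewrite ltnS leq_mul2r Hsz orbT.
- apply: wp_while => // i M Hi Hc' [Hs H25 H18 Hb].
  apply: (wp_weaken (leqnn _) (select_body_spec Hi Hsz Hs Hlt H25 H18 Hb)).
  move=> M' _ [Hs' H25' H18' H10' Hb']; split=> //; last by lia.
  exact: base_0 (stored_base Hs').
move=> M _ [[Hs _ _ [Hb Hmax]] _]; split; first exact: stored_base Hs.
have Hmax' v x : reach W m v x -> v %% D <= b -> score D n v <= M 26.
  by move=> /Ha/(nthP 0)[l Hl <-]; apply: Hmax.
(* The empty set is feasible and its score is positive, so register 26 cannot still hold its initial
   0. *)
have H0 : reach W m 0 0 by apply: (@reach_mono W 0 m) => //; constructor.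
have := Hmax' _ _ H0; rewrite mod0n => /(_ isT) Hpos.
case: Hb => [H26|[v [Hv Hvb H26 H27]]].
  by have := @score_gt0 D n 0 isT; lia.
have [x Hx Tx] := Hr v Hv; exists v, x; split=> //; first by rewrite H27.
by move=> v' x' Hx' Hb'; rewrite -H26; apply: Hmax' Hx' Hb'.
Qed.

Definition unpacked (k : nat) (x : nat) (M : memory) : Prop :=
  forall l, l < k -> M (B + l) = bit x l.

Lemma unpack_spec x M0 : x < 2 ^ m -> base M0 -> M0 27 = x.+1 ->
  wp V unpack M0 (5 + m * 9) (fun M => [/\ M 0 = B, M 1 = m, M 4 = 0, M 5 = 1 &
    unpacked m x M]).
Proof.
move=> Hxm [H0 H1 _ _ H4 H5 _] H27; have [B1 B2 B3 B4 B5] := addr_facts.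
pose I i M := [/\ [/\ M 0 = B, M 1 = m, M 4 = 0, M 5 = 1 & M 16 = 2],
  M 27 = x %/ 2 ^ i, M 18 = B + i & unpacked i x M].
apply: (@wp_then _ _ _ _ 4 (m * 9).+1 _ (fun M => I 0 M /\ M 10 = m)).
- by lia.
- step v27 E27 => //.
  step v16 E16; first exact: vconst.
  step v10 E10; first by lia.
  step v18 E18; first by lia.
  apply: wp_nil; split; rewrite ?upd_eqE /=; last by lia.
  split; rewrite ?upd_eqE /= ?expn0 ?divn1; try lia.
    by split; rewrite ?upd_eqE /=.
  by [].
move=> {H0 H1 H4 H5 H27 M0} M0 _ [HI Hc].
apply: (@wp_weaken _ _ _ (m * 9).+1 _ (fun M => I m M /\ M 10 = 0)) => //; last first.
  by move=> M _ [[[]]].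
apply: wp_while => // i M Hi Hc' [[H0 H1 H4 H5 H16] H27 H18 Hx].
have HxV : x %/ 2 ^ i <= V.
  by apply: leq_trans (leq_div _ _) _; move: V_big; lia.
step v15 E15 => //.
have {}E15 : v15 = x %/ 2 ^ i.+1 by rewrite E15 H27 H16 -divnMA -expnSr.
step v17 E17.
  rewrite E15 H16 expnSr divnMA (leq_trans (leq_trunc_div _ _)) //.
step w17 F17 => //.
have {E17}F17 : w17 = bit x i by rewrite F17 E17 E15 H16 H27 bit_div2.
step a Ea => //.
have Hlow y z : y < 32 -> upd z (M 18) a y = z y.
  by move=> Hy; rewrite upd_ne //; lia.
have Hlow2 y : y < 32 -> (y == M 18) = false by move=> Hy; apply/eqP; lia.
step v27 E27; first by rewrite !Hlow2 // E15 H4 addn0 expnS mulnC divnMA (leq_trans (leq_div _ _)).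
rewrite !Hlow2 // in E27.
step v18 E18; first by rewrite !Hlow2 //; lia.
rewrite !Hlow2 // in E18.
step v10 E10 => //.
rewrite !Hlow2 // in E10.
apply: wp_nil; split; rewrite ?upd_eqE /= ?Hlow2 //; first by lia.
split; rewrite ?upd_eqE /= ?Hlow2 //; try lia.
move=> l; rewrite ltnS leq_eqVlt => /orP[/eqP ->|Hl].
  by rewrite -H18 3?upd_ne ?upd_eq ?Ea ?F17 //; lia.
by rewrite !upd_ne ?Hx //; lia.
Qed.

Lemma copy_high_spec x M0 : M0 0 = B -> M0 1 = m -> M0 4 = 0 -> M0 5 = 1 ->
  unpacked m x M0 ->
  wp V copy_high M0 (5 + m * 7) (fun M => [/\ M 0 = B, unpacked m x M &
    forall l, 31 < l < m -> M l = bit x l]).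
Proof.
move=> H0 H1 H4 H5 Hx; have [B1 B2 B3 B4 B5] := addr_facts.
have BE := base_addrE n m.
pose I i M := [/\ [/\ M 0 = B, M 4 = 0 & M 5 = 1], M 18 = B + 32 + i, M 11 = 32 + i,
  unpacked m x M & forall l, 31 < l < 32 + i -> M l = bit x l].
apply: (@wp_then _ _ _ _ 4 (m * 7).+1 _ (fun M => I 0 M /\ M 10 = m - 32)).
- by lia.
- step v16 E16; first exact: vconst.
  step v10 E10 => //.
  step v18 E18; first by lia.
  step v11 E11; first by lia.
  apply: wp_nil; split; rewrite ?upd_eqE /=; last by lia.
  split; rewrite ?upd_eqE /=; try lia.
  + by split; rewrite ?upd_eqE /=.
  + by move=> l Hl; rewrite !upd_ne ?Hx //; lia.
move=> {H0 H1 H4 H5 Hx M0} M0 _ [HI Hc].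
apply: (@wp_weaken _ _ _ ((m - 32) * 7).+1 _ (fun M => I (m - 32) M /\ M 10 = 0)).
- by lia.
- apply: wp_while => // i M Hi Hc' [[H0 H4 H5] H18 H11 Hx Hl].
  step v17 E17 => //.
  have {}E17 : v17 = bit x (32 + i) by rewrite E17 H18 -addnA Hx //; lia.
  step a Ea => //.
  have Hlow2 y : y < 32 -> (y == M 11) = false by move=> Hy; apply/eqP; lia.
  step v18 E18; first by rewrite !Hlow2 //; lia.
  rewrite !Hlow2 // in E18.
  step v11 E11; first by rewrite !Hlow2 //; lia.
  rewrite !Hlow2 // in E11.
  step v10 E10 => //.
  rewrite !Hlow2 // in E10.
  apply: wp_nil; split; rewrite ?upd_eqE /= ?Hlow2 //; first by lia.
  split; rewrite ?upd_eqE /= ?Hlow2 //; try lia.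
  + by move=> l Hlm; rewrite !upd_ne ?Hx //; lia.
  + move=> l Hl'; have [->|/eqP Hne] := eqVneq l (32 + i).
      by rewrite -H11 3?upd_ne ?upd_eq ?Ea ?E17 ?H11 //; lia.
    by rewrite !upd_ne; [apply: Hl; lia|..]; lia.
move=> M _ [[[H0 _ _] _ _ Hx Hl] _]; split=> // l Hlm; apply: Hl; lia.
Qed.

Lemma load_low_regs_spec rs M : M 0 = B -> all (fun r => 1 < r < 32) rs ->
  okl V (load_low_regs rs) M /\
  forall y, y <> 1 -> runl (load_low_regs rs) M y =
    if y \in rs then M (B + y) else M y.
Proof.
have [B1 B2 B3 B4 B5] := addr_facts.
elim: rs M => [|r rs IH] M M0 //= /andP[Hr Hrs].
rewrite !upd_eqE /= M0.
set M1 := upd (upd (upd M 1 r) 1 (r + B)) r _.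
have E1 : M1 = upd (upd (upd M 1 r) 1 (r + B)) r (M (B + r)).
  by rewrite /M1; congr (upd _ _ _); upds; rewrite addnC.
have [|Hok Hrun] := IH M1 _ Hrs.
  by rewrite E1 !upd_eqE; upds.
split; first by do ! split=> //; lia.
move=> y Hy; rewrite Hrun // inE.
case Hin: (y \in rs).
  rewrite orbT E1 !upd_eqE.
  by upds.
by rewrite orbF E1 !upd_eqE; upds; congr (M (B + _)).
Qed.

Lemma copy_low_spec x M0 : M0 0 = B -> unpacked m x M0 ->
  (forall l, 31 < l < m -> M0 l = bit x l) ->
  wp V copy_low M0 94 (fun M => forall l, l < m -> M l = bit x l).
Proof.
move=> H0 Hx Hl; have [B1 B2 B3 B4 B5] := addr_facts.
have [Hok Hrun] := load_low_regs_spec (rs := iota 2 30) H0 isT.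
apply: (@wp_then _ _ _ _ 90 4 _ (fun M => [/\ M 0 = B, unpacked m x M &
    forall l, 1 < l < m -> M l = bit x l])) => //.
  apply: wp_blk => // _; split.
  - by rewrite Hrun.
  - by move=> l Hlm; rewrite Hrun; [rewrite mem_iota; case: ifP => [|_]; [lia|exact: Hx]|lia].
  - move=> l Hlm; rewrite Hrun; last by lia.
    by rewrite mem_iota; case: ifP => Hr; [apply: Hx|apply: Hl]; lia.
move=> {Hok Hrun Hl Hx H0 M0} M0 _ [H0 Hx Hl].
step v1 E1; first exact: vconst.
step w1 F1; first by lia.
have {E1}F1 : w1 = B + 1 by lia.
step v E1 => //.
have {}E1 : v = M0 (B + 1) by rewrite E1 F1; upds.
step a Ea => //.
have {}Ea : a = M0 B by rewrite Ea H0; upds.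
apply: wp_nil => -[|[|l]] Hlm; rewrite ?upd_eqE //=.
- by rewrite Ea -(addn0 B) Hx.
- by rewrite E1 Hx.
- by apply: Hl.
Qed.

End Output.

(** * Running time *)

Lemma code_at_self p : code_at p 0 p.
Proof. by exists [::], [::]; rewrite cats0. Qed.

(** The program is one fixed list, so it can be checked by computation that 1000 bounds all its
    register numbers, constants and labels. *)
Lemma wf_main : all (wfI 1000) (compile 0 main).
Proof. by vm_compute. Qed.

Lemma wp_exec V c M n Q : allb V M -> 1000 <= V -> all (wfI 1000) (compile 0 c) ->
  wp V c M n Q ->
  exists fuel M' t, [/\ exec (compile 0 c) fuel 0 M = Some (M', t),
    t <= n * (1 + 5 * bits V) & Q M'].
Proof.
move=> HM HV Hwf H; have [n' [M' [Hn B HQ]]] := H HM.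
have [t Ht E] := exec_bs B HM HV Hwf (code_at_self _).
(* The extra unit of fuel is for the fetch past the end of the program, which halts at cost 0. *)
exists (n' + 1), M', t; split=> //; last first.
  by rewrite (leq_trans Ht) // leq_mul2r Hn orbT.
by rewrite E /exec nth_default //= addn0.
Qed.

Lemma init_memE inp x : init_mem inp x = nth 0 inp x.
Proof. by []. Qed.

Section Main.
Variables (k d : nat) (I : PB).
Notation n := (nV I).
Notation m := (nP I).
Notation b := (bud I).
Notation inp := (encode I).
Notation N := (input_size inp).
Notation P := (N.+1 ^ 2).
Notation Smax := ((d * m).+1 ^ k.+1).
Notation D := (radix m inp).
(** 1064 = 64 + 1000 serves both the layout and [wf_main], and 2^N bounds the initial memory
    cells. *)
Notation V := (table_addr n m + 4 * D ^ n.+2 + 2 * Smax + 2 * 2 ^ m + b + 1064 + 2 ^ N).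
Notation nsteps := (112 + (3 + m + n * m) * 7 + 17 + m * (28 + n * 8 + Smax * 18) +
  6 + Smax * (22 + n * 10) + 5 + m * 9 + 5 + m * 7 + 94).

Lemma radixE : D = (costS [set: 'I_m]).+1.
Proof.
by congr _.+1; rewrite costS_sum; apply: eq_bigr => p _; rewrite inE mul1n.
Qed.

Lemma main_wp0 : m = 0 ->
  wp V main (init_mem inp) 1 (fun M => mpb_solution (decode I M)).
Proof.
move=> m0; apply: wp_if => [|_]; first by rewrite /init_mem /= m0.
have Hall (S T : {set 'I_m}) : S = T.
  by apply/setP => -[p Hp]; exfalso; move: Hp; rewrite m0.
split=> [|T _]; last by rewrite (Hall T (decode I (init_mem inp))).
by rewrite /feasible (Hall (decode I _) set0) /costS big_set0.
Qed.

Lemma main_wp : distinct_votes I <= k -> (scalable_limit I <= d%:R)%R -> 0 < m ->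
  wp V main (init_mem inp) nsteps (fun M => mpb_solution (decode I M)).
Proof.
move=> few_votes small_limit m_gt0; have -> : nsteps = (nsteps.-1).+1 by lia.
apply: wp_if => [_|]; last by rewrite /init_mem /= => m0; rewrite m0 in m_gt0.
set W := weight D (in_cost inp) (in_appr inp m) n.
have WE : W = weight (costS [set: 'I_m]).+1 (in_cost inp) (in_appr inp m) n.
  by rewrite /W radixE.
have W_lt : \sum_(j < m) W j < D ^ n.+1 by rewrite WE radixE; apply: sum_weight_lt.
have Hcount (q : seq nat) : uniq q ->
    (forall v, v \in q -> exists x, reach W m v x) -> size q <= Smax.
  by rewrite WE; apply: reachable_count.
have HV : table_addr n m + 4 * D ^ n.+2 + 2 * Smax + 2 * 2 ^ m + b + 64 <= V by lia.
have Haddr : table_addr n m + 64 <= V by lia.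
have Hsz := size_encode I.
have Hpro := @prologue_spec n m b V inp m_gt0 Haddr erefl erefl erefl Hsz _ (init_memE inp).
pose s6 := 94; pose s5 := 5 + m * 7 + s6; pose s4 := 5 + m * 9 + s5.
pose s3 := 6 + Smax * (22 + n * 10) + s4.
pose s2 := 17 + m * (28 + n * 8 + Smax * 18) + s3.
apply: (@wp_then _ _ _ _ _ s2 _ _ _ _ Hpro); last first.
  move=> M1 _ [Hb Hz].
  apply: (@wp_then _ _ _ _ _ s3 _ _ _ _ (build_table_spec m_gt0 HV W_lt Hcount Hb Hz));
    first exact: leqnn.
  move=> {Hb Hz M1} M1 _ [q [T [Hs H8 Hf]]].
  apply: (@wp_then _ _ _ _ _ s4 _ _ _ _ (select_spec m_gt0 HV W_lt Hcount Hs H8 Hf));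
    first exact: leqnn.
  move=> {Hs H8 Hf M1} M1 _ [Hb [v [x [H27 Hx Hvb Hopt]]]].
  apply: (@wp_then _ _ _ _ _ s5 _ _ _ _
    (unpack_spec m_gt0 HV W_lt (reach_lt Hx) Hb H27)); first exact: leqnn.
  move=> {Hb H27 M1} M1 _ [H0 H1 H4 H5 Hu].
  apply: (@wp_then _ _ _ _ _ s6 _ _ _ _
    (copy_high_spec m_gt0 HV W_lt H0 H1 H4 H5 Hu)); first exact: leqnn.
  move=> {H0 H1 H4 H5 Hu M1} M1 _ [H0 Hu Hl].
  apply: (wp_weaken (leqnn _) (copy_low_spec m_gt0 HV W_lt H0 Hu Hl)).
  move=> M _ HM.
  have -> : decode I M = mask_set I x.
    by apply/setP => j; rewrite !inE HM //; case: bit.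
  rewrite -/W WE in Hx Hopt; rewrite radixE in Hvb Hopt.
  exact: best_mask_solution Hx Hvb Hopt.
by rewrite /s2 /s3 /s4 /s5 /s6; lia.
Qed.

Lemma input_boundE : 3 + m + n * m <= N.
Proof. by rewrite -size_encode leq_addr. Qed.

(** The number n is itself stored in binary; it is the approval matrix, with its n m cells, that
    forces n to be at most the input size. *)
Lemma nV_le : 0 < m -> n <= N.
Proof.
move=> m_gt0; apply: leq_trans input_boundE.
by rewrite (leq_trans _ (leq_addl _ _)) // leq_pmulr.
Qed.

(** 376 is the sum of the coefficients of [nsteps]: each of the monomials 1, m, n m, [Smax], m
    [Smax] and n [Smax] is at most (N + 1) [Smax]. *)
Lemma nsteps_le : 0 < m -> nsteps <= 376 * (N.+1 * Smax).
Proof.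
move=> m_gt0; have Hn := nV_le m_gt0; have Hi := input_boundE.
have S0 : 0 < Smax by rewrite expn_gt0.
move: Hn Hi S0; move: Smax N => S X Hn Hi S0.
have H1 : m * S <= X * S by rewrite leq_mul2r; apply/orP; right; lia.
have H2 : n * S <= X * S by rewrite leq_mul2r Hn orbT.
have H3 : X * 1 <= X * S by rewrite leq_mul2l S0 orbT.
have -> : m * (28 + n * 8 + S * 18) = 28 * m + 8 * (n * m) + 18 * (m * S).
  by rewrite !mulnDr; lia.
have -> : S * (22 + n * 10) = 22 * S + 10 * (n * S) by rewrite mulnDr; lia.
have -> : X.+1 * S = S + X * S by rewrite mulSn.
lia.
Qed.

(** The exponent is quadratic because D^(n+2) may have N (n + 2) bits. With 1064 bounded by 2 *
    2^10, which explains the 10, the coefficients of the summands add up to at most 92, and the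
    seven further bits of 17 = 10 + 7 absorb them. *)
Lemma V_le : V <= 2 ^ (P * (17 + d * k.+1)).
Proof.
have Hi := input_boundE.
have P1 : N < P by rewrite expnS expn1 leq_pmulr.
have [P0 PN] : 0 < P /\ N * N.+2 < P by split; [rewrite expn_gt0|rewrite expnS expn1; lia].
have D_le : D <= 2 ^ N by rewrite radixE; apply: costS_setT_lt.
have pw x : x <= P * (10 + d * k.+1) -> 2 ^ x <= 2 ^ (P * (10 + d * k.+1)).
  by move=> Hx; rewrite leq_exp2l.
have H1 : table_addr n m <= 80 * 2 ^ (P * (10 + d * k.+1)).
  apply: (@leq_trans (80 * 2 ^ N)); last by rewrite leq_mul2l pw //; lia.
  rewrite /table_addr base_addrE; have := ltn_expl N (isT : 1 < 2); lia.
have H2 : D ^ n.+2 <= 2 ^ (P * (10 + d * k.+1)).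
  (* Without projects the input size does not bound n, but then D = 1 and its powers are
     harmless. *)
  have [m0|m_gt0] := posnP m.
    suff -> : D = 1 by rewrite exp1n expn_gt0.
    by rewrite /radix m0 big_ord0.
  apply: (@leq_trans ((2 ^ N) ^ n.+2)); first by rewrite leq_exp2r.
  rewrite -expnM pw //; have := nV_le m_gt0 => Hn.
  have : N * n.+2 <= N * N.+2 by rewrite leq_mul2l !ltnS Hn orbT.
  lia.
have H3 : Smax <= 2 ^ (P * (10 + d * k.+1)).
  apply: (@leq_trans ((2 ^ (d * m)) ^ k.+1)); first by rewrite leq_exp2r // ltn_expl.
  rewrite -expnM pw // mulnDr (leq_trans _ (leq_addl _ _)) //.
  rewrite (mulnC d) -mulnA leq_mul2r; apply/orP; right; lia.
have H4 : 2 ^ m <= 2 ^ (P * (10 + d * k.+1)) by apply: pw; lia.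
have H5 : 2 ^ N <= 2 ^ (P * (10 + d * k.+1)) by apply: pw; lia.
have H6 : b < 2 ^ N by have := nth_input_lt I 2.
have H7 : 2 ^ 10 <= 2 ^ (P * (10 + d * k.+1)) by apply: pw; lia.
apply: (@leq_trans (2 ^ 7 * 2 ^ (P * (10 + d * k.+1)))); last first.
  by rewrite -expnD leq_exp2l //; lia.
by move: H1 H2 H3 H4 H5 H6 H7; move: (2 ^ (P * _)) => Z; lia.
Qed.

End Main.

Theorem theorem4 :
  forall k d : nat,
  exists (p : program) (c : nat),
  forall I : PB,
    distinct_votes I <= k ->
    (scalable_limit I <= d%:R)%R ->
    exists (fuel : nat) (M : memory) (t : nat),
      exec p fuel 0 (init_mem (encode I)) = Some (M, t) /\
      t <= c * (input_size (encode I)).+1 ^ c /\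
      mpb_solution (decode I M).
Proof.
move=> k d.
(* In A, 376 comes from the number of steps, 91 = 1 + 5 + 5 * 17 from the bits of V, and (d+1)^(k+1)
   from extracting N + 1 out of [Smax]. The degree is k + 4 = 1 + (k + 1) + 2, and A + (k + 4)
   serves both as factor and as exponent. *)
pose A := 376 * (91 + 5 * (d * k.+1)) * d.+1 ^ k.+1.
exists (compile 0 main), (A + (k + 4)) => I few_votes small_limit.
set N := input_size (encode I).
have HV := V_le k d I; set V := (X in X <= _) in HV; rewrite -/N in HV.
have HA : allb V (init_mem (encode I)).
  move=> x; rewrite /init_mem (leq_trans (ltnW (nth_input_lt I x))) // /V; lia.
have HbV : 1 + 5 * bits V <= N.+1 ^ 2 * (91 + 5 * (d * k.+1)).
  have : bits V <= (N.+1 ^ 2 * (17 + d * k.+1)).+1.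
    by rewrite /bits ltnS -[X in _ <= X](trunc_expnK _ (isT : 1 < 2)) leq_trunc_log.
  have : 0 < N.+1 ^ 2 by rewrite expn_gt0.
  by rewrite !mulnDr; lia.
have HV0 : 1000 <= V by rewrite /V; lia.
pose T := 376 * (N.+1 * (d * nP I).+1 ^ k.+1).
have Hwp : wp V main (init_mem (encode I)) T (fun M => mpb_solution (decode I M)).
  have [m0|m_gt0] := posnP (nP I).
    apply: (wp_weaken _ (@main_wp0 k d I m0)) => //.
    by rewrite /T !muln_gt0 expn_gt0.
  by apply: (wp_weaken _ (main_wp few_votes small_limit m_gt0)) => //; apply: nsteps_le.
have [fuel [M [t [Hex Ht HQ]]]] := wp_exec HA HV0 wf_main Hwp.
exists fuel, M, t; split=> //; split=> //.
apply: (leq_trans Ht); apply: (@leq_trans (A * N.+1 ^ (k + 4))).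
  apply: leq_trans (leq_mul (leqnn T) HbV) _.
  have H1 : (d * nP I).+1 ^ k.+1 <= d.+1 ^ k.+1 * N.+1 ^ k.+1.
    rewrite -expnMn leq_exp2r // mulSn addSn ltnS (leq_trans _ (leq_addl _ _)) //.
    by rewrite leq_mul2l; apply/orP; right; have := input_boundE I; rewrite -/N; lia.
  rewrite /T /A (_ : k + 4 = 1 + k.+1 + 2); last by lia.
  rewrite !expnD expn1.
  move: H1; move: ((d * nP I).+1 ^ k.+1) (d.+1 ^ k.+1) (N.+1 ^ k.+1) (N.+1 ^ 2) => x y z w.
  move: (91 + _) N.+1 => u v H1.
  have -> : 376 * (v * x) * (w * u) = 376 * v * w * u * x by lia.
  have -> : 376 * u * y * (v * z * w) = 376 * v * w * u * (y * z) by lia.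
  by rewrite leq_mul2l H1 orbT.
by apply: leq_mul; rewrite ?leq_addr // leq_pexp2l // leq_addl.
Qed.
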